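(* In the setting fixed in the context (network classes $\mathcal N(N,L,r)$; the approximability, topological, forward-operator, regularizer and expansion-schedule assumptions; Algorithm I, with an explicit radius bound, and Algorithm II, without one), for each $\delta>0$ let $f^\delta$ denote the approximate solution of $A(f)=g$ generated from data $g^\delta$ with $\|g^\delta-g\|_{\mathcal Y}\le\delta$ by either Algorithm I or Algorithm II. Then the following assertions hold. (a) Existence. For every $\delta>0$, all $N,L\in\mathbb N^+$ and every radius $r>0$, the minimization problem $$\min_{\phi\in\mathcal N(N,L,r)}\Big(\|A(\phi)-g^\delta\|_{\mathcal Y}+\beta_{N,L}\mathcal R(\phi)\Big)$$ admits at least one minimizer. (b) Finite termination and architecture control. For every $\delta>0$, both Algorithm I and Algorithm II terminate after finitely many steps. In particular, the stopping index $k(\delta)$ of Algorithm I and the Phase 1 stopping index $k(\delta)$ of Algorithm II satisfy $$k(\delta)\le\max\{k_N^*(\delta),k_L^*(\delta)\},$$ where $k_N^*(\delta)=\min\{k\in\mathbb N^+:N_k\ge N_{\rm tar}(\delta)\}$ and $k_L^*(\delta)=\min\{k\in\mathbb N^+:L_k\ge L_{\rm tar}(\delta)\}$. Moreover, if Algorithm II enters Phase 2, then the corresponding radius-inflation index $j(\delta)$ is finite. The width $N(\delta)$ and depth $L(\delta)$ selected by either algorithm satisfy $$N(\delta)\le\max\{N_1,\,C_N N_{\rm tar}(\delta)\},\qquad L(\delta)\le\max\{L_1,\,C_L L_{\rm tar}(\delta)\}.$$ (c) Convergence. For every sequence $\delta_n\downarrow0$, $$f^{\delta_n}\rightharpoonup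 f^\dagger\ \text{ in }\mathcal X_1,\qquad A(f^{\delta_n})\to g\ \text{ in }\mathcal Y\qquad(n\to\infty).$$ If, in addition, there is a Banach space $\mathcal X_2$ such that $\mathcal X_1$ is compactly embedded into $\mathcal X_2$, then $f^{\delta_n}\to f^\dagger$ in $\mathcal X_2$ as $n\to\infty$.
   Context: **Network classes.** $\Omega\subset\mathbb R^d$ is a bounded domain, $\sigma:\mathbb R\to\mathbb R$ is continuous and acts componentwise. For depth $K\in\mathbb N^+$ (number of hidden layers) and widths $N_0=d,N_1,\dots,N_K,N_{K+1}=1$ (layer widths, not to be confused with the schedule below), a parameter set is $\Theta=\{(W_\ell,b_\ell)\}_{\ell=1}^{K+1}$ with $W_\ell\in\mathbb R^{N_\ell\times N_{\ell-1}}$, $b_\ell\in\mathbb R^{N_\ell}$. The realization $\phi(\cdot;\Theta):\overline\Omega\to\mathbb R$ is given by $\widetilde\phi_0(x)=x$; $\phi_\ell(x)=W_\ell\widetilde\phi_{\ell-1}(x)+b_\ell$, $\widetilde\phi_\ell(x)=\sigma(\phi_\ell(x))$ for $\ell=1,\dots,K$; $\phi(x;\Theta)=W_{K+1}\widetilde\phi_K(x)+b_{K+1}$. $\|\Theta\|$ is any fixed norm on the finite-dimensional parameter space of the chosen architecture. For $N,L\in\mathbb N^+$, $r>0$, $$\mathcal N(N,L,r)=\{\phi(\cdot;\Theta)\in C(\overline\Omega): K\le L,\ \max_{1\le\ell\le K}N_\ell\le N,\ \|\Theta\|\le r\}.$$ **Problem.** $\mathcal X_A,\mathcal Y$ are Banach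 spaces, $A:\mathcal X_A\to\mathcal Y$, $g=A(f^\dagger)$ is exact data with $f^\dagger\in\mathcal F$, and for every $\delta>0$ the data $g^\delta\in\mathcal Y$ satisfies $\|g^\delta-g\|_{\mathcal Y}\le\delta$. **Assumption 1 (approximability).** $\mathcal X_1$ is a Banach space, $\mathcal F\subset\mathcal X_1$. There are $N_{\min},L_{\min}\in\mathbb N^+$ and numbers $\mathcal E_{N,L}\in[0,\infty)$ ($N\ge N_{\min}$, $L\ge L_{\min}$), nonincreasing in each argument, with $\lim_{N,L\to\infty}\mathcal E_{N,L}=0$, such that for every $f\in\mathcal F$ and all $N\ge N_{\min}$, $L\ge L_{\min}$ there exist a finite $r>0$ (possibly depending on $f,N,L$) and $\phi\in\mathcal N(N,L,r)$ with $\|f-\phi\|_{\mathcal X_1}\le\mathcal E_{N,L}$. **Assumption 2 (topological setting).** $\mathcal X_1$ is a reflexive Banach space of functions on $\Omega$ and $\mathcal X_0$ is a Banach space of functions on $\Omega$ such that: (i) $\mathcal N(N,L,r)\subset\mathcal X_1$ for all $N,L\in\mathbb N^+$, $r>0$; (ii) $\mathcal X_1\hookrightarrow\mathcal X_0$ continuously; (iii) for every fixed $(N,L,r)$, $\mathcal N(N,L,r)$ is compact in $\mathcal X_0$. **Assumption 3 (forward operator).** (i) $\mathcal X_1\hookrightarrow\mathcal X_A$ continuously. (ii) If $f_m\rightharpoonup f$ in $\mathcal X_1$ with $\sup_m\|f_m\|_{\mathcal X_1}<\infty$, then $A(f_m)\rightharpoonup A(f)$ in $\mathcal Y$. (iii)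 The equation $A(f)=g$ has a unique solution $f^\dagger$ in $\mathcal X_1$. (iv) There are $\theta\in(0,1]$, $L_A>0$, $\eta>0$ with $\|A(f)-A(f^\dagger)\|_{\mathcal Y}\le L_A\|f-f^\dagger\|_{\mathcal X_1}^\theta$ for all $f\in\mathcal X_1$ with $\|f-f^\dagger\|_{\mathcal X_1}\le\eta$. **Assumption 4 (regularizer).** $\mathcal R:\mathcal X_1\to[0,\infty]$ is proper and: (i) sequentially weakly lower semicontinuous on $\mathcal X_1$; (ii) coercive: $\mathcal R(f)\to\infty$ as $\|f\|_{\mathcal X_1}\to\infty$; (iii) for every $(N,L,r)$ there is $\phi\in\mathcal N(N,L,r)$ with $\mathcal R(\phi)<\infty$; (iv) there is $C_{f^\dagger}>0$, independent of $(N,L)$, such that the approximants $\phi_{N,L}$ of $f^\dagger$ in Assumption 1 can be chosen with $\mathcal R(\phi_{N,L})\le C_{f^\dagger}$ for all $N\ge N_{\min}$, $L\ge L_{\min}$. **Objective and weights.** Fix $\tau>1$, $c_0>0$. Set $\overline{\mathcal E}_{N,L}=\mathcal E_{N_{\min},L_{\min}}$ if $N<N_{\min}$ or $L<L_{\min}$, and $\overline{\mathcal E}_{N,L}=\mathcal E_{N,L}$ otherwise; $\beta_{N,L}=c_0\overline{\mathcal E}_{N,L}^{\,\theta}$; $J^\delta_{N,L,r}(\phi)=\|A(\phi)-g^\delta\|_{\mathcal Y}+\beta_{N,L}\mathcal R(\phi)$ for $\phi\in\mathcal N(N,L,r)$. **Target architecture.** For $\delta>0$, $$\mathcal E_\delta=\min\Big\{\big(\tfrac{\tau-1}{2L_A}\delta\big)^{1/\theta},\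 \big(\tfrac{\tau-1}{2c_0C_{f^\dagger}}\delta\big)^{1/\theta},\ \eta\Big\},$$ and $N_{\rm tar}(\delta)\ge N_{\min}$, $L_{\rm tar}(\delta)\ge L_{\min}$ are integers selected such that $q_0\mathcal E_\delta\le\mathcal E_{N_{\rm tar}(\delta),L_{\rm tar}(\delta)}\le\mathcal E_\delta$, for some constant $q_0\in(0,1]$ (independent of $\delta$). **Assumption 5 (expansion schedules).** $\{N_k\}_{k\ge1},\{L_k\}_{k\ge1}\subset\mathbb N^+$ are nondecreasing and unbounded, and: (i) there are $C_N,C_L\ge1$ with $N_{k+1}\le C_NN_k$, $L_{k+1}\le C_LL_k$ for all $k\ge1$. (ii) With $k_N^*(\delta)=\min\{k:N_k\ge N_{\rm tar}(\delta)\}$, $k_L^*(\delta)=\min\{k:L_k\ge L_{\rm tar}(\delta)\}$, $k^*(\delta)=\max\{k_N^*(\delta),k_L^*(\delta)\}$, one has $N_k=N_{k_N^*(\delta)}$ for all $k\in[k_N^*(\delta),k^*(\delta)]$ and $L_k=L_{k_L^*(\delta)}$ for all $k\in[k_L^*(\delta),k^*(\delta)]$. (iii) There is $q_{\rm sc}\in(0,1]$ with $\mathcal E_{C_NN,\,C_LL}\ge q_{\rm sc}\,\mathcal E_{N,L}$ for all integers $N\ge N_{\min}$, $L\ge L_{\min}$, where non-integer indices are rounded up. **Algorithm I (explicit radius bound available).** Here one is given $r_{\max}:\mathbb N^+\times\mathbb N^+\to(0,\infty)$, nondecreasing in each argument, which is an admissible radius bound: for all $N\ge N_{\min}$, $L\ge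 L_{\min}$ the approximant $\phi_{N,L}$ of $f^\dagger$ (with $\|f^\dagger-\phi_{N,L}\|_{\mathcal X_1}\le\mathcal E_{N,L}$ and $\mathcal R(\phi_{N,L})\le C_{f^\dagger}$) can be chosen in $\mathcal N(N,L,r_{\max}(N,L))$. For $k=1,2,\dots$ set $r_k=r_{\max}(N_k,L_k)$ and let $f_k^\delta$ be a minimizer of $J^\delta_{N_k,L_k,r_k}$ over $\mathcal N(N_k,L_k,r_k)$. Stop at the first $k=:k(\delta)$ such that $N_k\ge N_{\min}$, $L_k\ge L_{\min}$, $\mathcal E_{N_k,L_k}\le\eta$ and $\|A(f_k^\delta)-g^\delta\|_{\mathcal Y}\le\tau\delta$. Output $f^\delta=f^\delta_{k(\delta)}$, $N(\delta)=N_{k(\delta)}$, $L(\delta)=L_{k(\delta)}$. **Algorithm II (no explicit radius bound).** Given are positive radii $\{r_k^{\mathrm I}\}_{k\ge1}$ and $\{r_j^{\mathrm{II}}\}_{j\ge1}$ with $r_j^{\mathrm{II}}\uparrow\infty$. Phase 1: for $k=1,2,\dots$ let $f^\delta_{k,0}$ be a minimizer of $J^\delta_{N_k,L_k,r_k^{\mathrm I}}$ over $\mathcal N(N_k,L_k,r_k^{\mathrm I})$ and $S_{k,0}=J^\delta_{N_k,L_k,r_k^{\mathrm I}}(f^\delta_{k,0})$. Phase 1 ends at the first $k=:k(\delta)$ at which $S_{k,0}\le\tau\delta$ or ($N_k\ge N_{\rm tar}(\delta)$ and $L_k\ge L_{\rm tar}(\delta)$). If $S_{k(\delta),0}\le\tau\delta$,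 the algorithm stops with $j(\delta)=0$, $f^\delta=f^\delta_{k(\delta),0}$, $N(\delta)=N_{k(\delta)}$, $L(\delta)=L_{k(\delta)}$. Otherwise it enters Phase 2. Phase 2: the architecture is frozen at $(N_{\rm tar}(\delta),L_{\rm tar}(\delta))$; for $j=1,2,\dots$ let $f^\delta_{k(\delta),j}$ be a minimizer of $J^\delta_{N_{\rm tar}(\delta),L_{\rm tar}(\delta),r_j^{\mathrm{II}}}$ over $\mathcal N(N_{\rm tar}(\delta),L_{\rm tar}(\delta),r_j^{\mathrm{II}})$. Stop at the first $j=:j(\delta)$ for which the minimal objective value is $\le\tau\delta$. Output $f^\delta=f^\delta_{k(\delta),j(\delta)}$, $N(\delta)=N_{\rm tar}(\delta)$, $L(\delta)=L_{\rm tar}(\delta)$. *)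

(* Defs.v *)
From HB Require Import structures.
From mathcomp Require Import all_boot all_order all_algebra.
From mathcomp Require Import all_classical all_reals all_analysis.

Set Implicit Arguments.
Unset Strict Implicit.
Unset Printing Implicit Defensive.

Import Order.TTheory GRing.Theory Num.Theory.
Import numFieldNormedType.Exports.

Local Open Scope classical_set_scope.
Local Open Scope ring_scope.

Section banach.
Context {R : realType}.
Implicit Types X Y : normedModType R.

Definition dual X (l : X -> R) : Prop := scalar l /\ continuous l.

Definition dual_norm X (l : X -> R) : R :=
  sup [set `|l x| | x in [set x : X | `|x| <= 1]].

(* Elements of the bidual are maps on all of [X -> R]; only their values at the
   continuous linear functionals matter. *)
Definition bidual X (Phi : (X -> R) -> R) : Prop :=
  (forall (a : R) (l m : X -> R), dual l -> dual m ->
     Phi (fun x => a * l x + m x) = a * Phi l + Phi m) /\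
  (exists C : R, forall l : X -> R, dual l -> `|Phi l| <= C * dual_norm l).

Definition reflexive_space X : Prop :=
  forall Phi : (X -> R) -> R, bidual Phi ->
  exists x : X, forall l : X -> R, dual l -> Phi l = l x.

Definition weak_cvg X (u : nat -> X) (x : X) : Prop :=
  forall l : X -> R, dual l -> l (u n) @[n --> \oo] --> l x.

Definition embedding X Y (i : {linear X -> Y}) : Prop :=
  injective i /\ continuous i.

Definition compact_embedding X Y (i : {linear X -> Y}) : Prop :=
  embedding i /\ forall B : set X, bounded_set B -> precompact (i @` B).

(* A space of functions on Omega, whose elements may be functions or classes of
   functions (e.g. modulo equality almost everywhere): [represents x u] says
   that the function u belongs to the class x. *)
Record function_space (T : topologicalType) (Omega : set T) X := FunctionSpace {
  represents : X -> (Omega -> R) -> Prop;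
  represents_ex : forall x, exists u, represents x u;
  represents_inj : forall x y u, represents x u -> represents y u -> x = y;
  represents_lin : forall (a : R) x y u v, represents x u -> represents y v ->
    represents (a *: x + y) (fun t => a * u t + v t) }.

Definition function_embedding (T : topologicalType) (Omega : set T) X Y
    (fX : function_space Omega X) (fY : function_space Omega Y)
    (i : {linear X -> Y}) : Prop :=
  embedding i /\ forall x u, represents fX x u -> represents fY (i x) u.

End banach.

Section networks.
Context {R : realType}.

Definition is_norm (V : lmodType R) (p : V -> R) : Prop :=
  [/\ forall x, p x = 0 -> x = 0,
      forall x y, p (x + y) <= p x + p y &
      forall (a : R) x, p (a *: x) = `|a| * p x].

(* The parameters (W_l, b_l), l = 1..K+1, of an architecture with input width
   n, hidden widths ws = [:: N_1; ...; N_K] and output width 1. *)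
Fixpoint params (n : nat) (ws : seq nat) : lmodType R :=
  match ws with
  | [::] => ('M[R]_(1, n) * 'cV[R]_1)%type : lmodType R
  | w :: ws' => (('M[R]_(w, n) * 'cV[R]_w) * params w ws')%type : lmodType R
  end.

Fixpoint realization (sigma : R -> R) (n : nat) (ws : seq nat) :
    params n ws -> 'cV[R]_n -> R :=
  match ws return params n ws -> 'cV[R]_n -> R with
  | [::] => fun Theta x => (Theta.1 *m x + Theta.2) ord0 ord0
  | w :: ws' => fun Theta x =>
      realization sigma Theta.2 (map_mx sigma (Theta.1.1 *m x + Theta.1.2))
  end.

(* Realizations are taken on all of R^d; they are continuous when sigma is. *)
Definition networks (d : nat) (sigma : R -> R)
    (pnorm : forall ws, params d ws -> R) (N L : nat) (r : R) :
    set ('cV[R]_d -> R) :=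
  [set phi | exists (ws : seq nat) (Theta : params d ws),
     [/\ (0 < size ws <= L)%N, all (fun w => 0 < w <= N)%N ws,
         pnorm ws Theta <= r & phi = realization sigma Theta]].

(* The networks of the class, restricted to Omega, as elements of X. *)
Definition networks_in (d : nat) (Omega : set 'cV[R]_d) (X : normedModType R)
    (fX : function_space Omega X) (sigma : R -> R)
    (pnorm : forall ws, params d ws -> R) (N L : nat) (r : R) : set X :=
  [set f | exists2 phi, networks sigma pnorm N L r phi
                      & represents fX f (fun t : Omega => phi (val t))].

End networks.

Definition minimizer (R : realType) (X : Type) (S : set X) (J : X -> \bar R)
    (f : X) : Prop :=
  S f /\ forall h, S h -> (J f <= J h)%E.

Definition first_at (P : nat -> Prop) (k : nat) : Prop :=
  [/\ (0 < k)%N, P k & forall i, (0 < i < k)%N -> ~ P i].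

(* The least k >= 1 such that P k (0 if there is none). *)
Definition first_index (P : nat -> Prop) : nat := xget 0%N (first_at P).

Section regularization.
Context {R : realType}.

Definition error_ext (Nmin Lmin : nat) (E : nat -> nat -> R) (N L : nat) : R :=
  if (N < Nmin)%N || (L < Lmin)%N then E Nmin Lmin else E N L.

Definition weight (c0 theta : R) (Nmin Lmin : nat) (E : nat -> nat -> R)
    (N L : nat) : R :=
  c0 * error_ext Nmin Lmin E N L `^ theta.

Definition target_error (tau LA c0 C theta eta delta : R) : R :=
  Num.min (((tau - 1) / (2 * LA) * delta) `^ theta^-1)
    (Num.min (((tau - 1) / (2 * c0 * C) * delta) `^ theta^-1) eta).

(* If the weight is 0, then 0 * +oo = 0 here. *)
Definition objective (X Y : normedModType R) (A : X -> Y) (y : Y)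
    (beta : nat -> nat -> R) (Reg : X -> \bar R) (N L : nat) (f : X) : \bar R :=
  (`|A f - y|%:E + (beta N L)%:E * Reg f)%E.

Definition nat_ceil (x : R) : nat := `|Num.ceil x|%N.

End regularization.

Section algorithms.
Context {R : realType} {X Y : normedModType R}.
Variables (NN : nat -> nat -> R -> set X) (J : nat -> nat -> X -> \bar R).

(* The steps k >= 1 of an outer or inner loop; the minimizers are arbitrary.
   The sequence is continued past the stopping index, where it is irrelevant. *)
Definition iterates (Ns Ls : nat -> nat) (rs : nat -> R) (fs : nat -> X) : Prop :=
  forall k, (0 < k)%N ->
    minimizer (NN (Ns k) (Ls k) (rs k)) (J (Ns k) (Ls k)) (fs k).

Variables (Nk Lk : nat -> nat).

Definition algI_iterates (rmax : nat -> nat -> R) (fs : nat -> X) : Prop :=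
  iterates Nk Lk (fun k => rmax (Nk k) (Lk k)) fs.

Definition algI_stop (Nmin Lmin : nat) (E : nat -> nat -> R) (eta : R)
    (A : X -> Y) (y : Y) (bound : R) (fs : nat -> X) (k : nat) : Prop :=
  [/\ (Nmin <= Nk k)%N, (Lmin <= Lk k)%N, E (Nk k) (Lk k) <= eta &
      `|A (fs k) - y| <= bound].

(* [algI_returns .. f N L]: f, N, L are a possible output of the algorithm
   (one for each choice of the minimizers); [bound] is tau * delta. *)
Definition algI_returns (rmax : nat -> nat -> R)
    (Nmin Lmin : nat) (E : nat -> nat -> R) (eta : R)
    (A : X -> Y) (y : Y) (bound : R) (f : X) (N L : nat) : Prop :=
  exists (fs : nat -> X) (k : nat),
    [/\ algI_iterates rmax fs,
        first_at (algI_stop Nmin Lmin E eta A y bound fs) k &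
        [/\ f = fs k, N = Nk k & L = Lk k]].

Variables (Ntar Ltar : nat) (bound : R).

Definition algII_iterates1 (rI : nat -> R) (fs1 : nat -> X) : Prop :=
  iterates Nk Lk rI fs1.

Definition algII_accept1 (fs1 : nat -> X) (k : nat) : Prop :=
  (J (Nk k) (Lk k) (fs1 k) <= bound%:E)%E.

Definition algII_stop1 (fs1 : nat -> X) (k : nat) : Prop :=
  algII_accept1 fs1 k \/ ((Ntar <= Nk k)%N /\ (Ltar <= Lk k)%N).

Definition algII_iterates2 (rII : nat -> R) (fs2 : nat -> X) : Prop :=
  iterates (fun=> Ntar) (fun=> Ltar) rII fs2.

Definition algII_stop2 (fs2 : nat -> X) (j : nat) : Prop :=
  (J Ntar Ltar (fs2 j) <= bound%:E)%E.

Definition algII_returns (rI rII : nat -> R) (f : X) (N L : nat) : Prop :=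
  exists (fs1 : nat -> X) (k : nat),
    [/\ algII_iterates1 rI fs1, first_at (algII_stop1 fs1) k &
        (algII_accept1 fs1 k /\ [/\ f = fs1 k, N = Nk k & L = Lk k]) \/
        (~ algII_accept1 fs1 k /\
         exists (fs2 : nat -> X) (j : nat),
           [/\ algII_iterates2 rII fs2, first_at (algII_stop2 fs2) j &
               [/\ f = fs2 j, N = Ntar & L = Ltar]])].

End algorithms.

(* Main.v *)
(* All minimizers are compared with the approximant phi_{N,L} of f^dagger, for
   which J(phi) <= delta + (L_A + c_0 C) E_{N,L}^theta; this is at most tau delta
   once E_{N,L} <= E_delta, which gives termination.  Conversely, the frozen
   schedules never exceed the target architecture by more than boundedly many
   scaling steps, so E at the output is at least a constant times E_delta, hence
   beta >= const * delta for delta bounded, and R(f^delta) stays bounded.  The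
   growth condition and the unboundedness of the schedules force C_N, C_L > 1, so
   the scaling condition also shows that every E_{N,L} is positive.

   Existence of minimizers: a minimizing sequence converges in X_0, and for
   bounded sequences this is enough for weak convergence in X_1, because by
   reflexivity every ultrafilter limit exists in X_1 and is determined by its
   image in X_0.  Convergence: since A is only assumed to be sequentially weakly
   continuous, ultrafilter limits are first replaced by weakly convergent
   subsequences (Eberlein-Smulian); each such limit solves A(f) = g. *)

Require Import Defs.
From HB Require Import structures.
From mathcomp Require Import all_boot all_order all_algebra.
From mathcomp Require Import all_classical all_reals all_analysis.
From mathcomp Require Import ring lra.

Set Implicit Arguments.
Unset Strict Implicit.
Unset Printing Implicit Defensive.

Import Order.TTheory GRing.Theory Num.Theory.
Import numFieldNormedType.Exports.

Local Open Scope classical_set_scope.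
Local Open Scope ring_scope.

(** * Hahn-Banach *)

Section hahn_banach.
Context {R : realType} {V : lmodType R}.
Implicit Types (p q : V -> R) (x y : V).

Definition sublinear p :=
  (forall x y, p (x + y) <= p x + p y) /\
  (forall t x, 0 <= t -> p (t *: x) <= t * p x).

Lemma sublinear0 p : sublinear p -> p 0 = 0.
Proof.
move=> [pD pZ]; apply/eqP; rewrite eq_le; apply/andP; split.
  by have := pZ 0 0 (lexx _); rewrite scale0r mul0r.
by have := pD 0 0; rewrite addr0; lra.
Qed.

Lemma sublinearN p x : sublinear p -> - p (- x) <= p x.
Proof.
by move=> sp; have := sp.1 x (- x); rewrite subrr sublinear0//; lra.
Qed.

Lemma sublinear_ge p t x : sublinear p -> 0 <= t -> t * p x <= p (t *: x).
Proof.
move=> sp; rewrite le_eqVlt => /predU1P[<-|t0].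
  by rewrite scale0r mul0r sublinear0.
have := sp.2 t^-1 (t *: x); rewrite invr_ge0 (ltW t0) => /(_ isT).
by rewrite scalerA mulVf ?gt_eqF// scale1r ler_pdivlMl.
Qed.

(** For sublinear [q], taking [t = 0] shows that this stays below [q], and [t = 1] that it is at
    most [- q y] at [- y]; a linear functional below it therefore agrees with [q] at [y]. *)
Definition infshift q y x : R :=
  inf [set q (x + t *: y) - t * q y | t in [set t | 0 <= t]].

(** Bounds the set in [infshift] below, so that its [inf] is a true infimum and not a default
    value. *)
Let infshift_lb q y x t : sublinear q -> 0 <= t ->
  - q (- x) <= q (x + t *: y) - t * q y.
Proof.
move=> sq t0; have := sq.1 (x + t *: y) (- x); rewrite addrC addKr.
by have := sublinear_ge y sq t0; lra.
Qed.

Lemma infshift_le q y x t : sublinear q -> 0 <= t ->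
  infshift q y x <= q (x + t *: y) - t * q y.
Proof.
move=> sq t0; apply: ge_inf; last by exists t.
by exists (- q (- x)) => _ [s /= s0 <-]; exact: infshift_lb.
Qed.

Lemma le_infshift q y x c :
  (forall t, 0 <= t -> c <= q (x + t *: y) - t * q y) -> c <= infshift q y x.
Proof.
move=> h; apply: lb_le_inf; first by exists (q (x + 0 *: y) - 0 * q y), 0 => //=.
by move=> _ [t /= t0 <-]; exact: h.
Qed.

Lemma infshift_sublinear q y : sublinear q -> sublinear (infshift q y).
Proof.
move=> sq; split=> [x x'|t x].
  rewrite -lerBlDr; apply: le_infshift => s s0.
  rewrite lerBlDr -lerBlDl; apply: le_infshift => r r0.
  have := @infshift_le q y (x + x') (s + r) sq (addr_ge0 s0 r0).
  have := sq.1 (x + s *: y) (x' + r *: y).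
  by rewrite addrACA -scalerDl; lra.
rewrite le_eqVlt => /predU1P[<-|t0].
  rewrite scale0r mul0r; apply: (le_trans (@infshift_le q y 0 0 sq _)) => //.
  by rewrite scale0r addr0 mul0r subr0 sublinear0.
rewrite -ler_pdivrMl//; apply: le_infshift => s s0; rewrite ler_pdivrMl//.
have ts0 : 0 <= t * s by rewrite mulr_ge0// ltW.
apply: (le_trans (@infshift_le q y (t *: x) (t * s) sq ts0)).
rewrite -scalerA -scalerDr.
by have := sq.2 t (x + s *: y) (ltW t0); nra.
Qed.

(* A sublinear functional that is minimal among sublinear functionals is linear:
   it lies below each of its [infshift q y], which forces additivity. *)
Lemma minimal_sublinear q : sublinear q ->
  (forall q', sublinear q' -> (forall x, q' x <= q x) -> forall x, q x <= q' x) ->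
  scalar q.
Proof.
move=> sq qmin.
have qD x y : q (x + y) = q x + q y.
  apply/eqP; rewrite eq_le sq.1/= -lerBrDr.
  have := @infshift_le q y x 1 sq ler01; rewrite scale1r mul1r; apply: le_trans.
  apply/qmin; first exact: infshift_sublinear.
  move=> z; apply: (le_trans (@infshift_le q y z 0 sq _)) => //.
  by rewrite scale0r addr0 mul0r subr0.
have qN x : q (- x) = - q x.
  by apply/eqP; rewrite -addr_eq0 addrC -qD subrr sublinear0.
have qZ t x : 0 <= t -> q (t *: x) = t * q x.
  by move=> t0; apply/eqP; rewrite eq_le sq.2//= sublinear_ge.
move=> a x y; rewrite qD; congr (_ + _).
have [a0|a0] := leP 0 a; first exact: qZ.
by rewrite -[a]opprK scaleNr qN qZ ?mulNr// oppr_ge0 ltW.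
Qed.

(** The functional is a minimal sublinear one below [infshift p x0], found by Zorn's lemma:
    minimality makes it linear, and the shift fixes its value at [x0]. *)
Lemma hahn_banach p x0 : sublinear p ->
  exists l, [/\ scalar l, forall x, l x <= p x & l x0 = p x0].
Proof.
move=> sp; pose p0 := infshift p x0.
have sp0 : sublinear p0 by exact: infshift_sublinear.
pose T := {q | sublinear q /\ forall x, q x <= p0 x}.
(* The order is reversed, so that a maximal element in Zorn's lemma is a minimal functional. *)
pose below (s t : T) := `[< forall x, sval t x <= sval s x >].
(* A common lower bound at each point makes the infimum over a chain finite. *)
have lbT (q : T) x : - p0 (- x) <= sval q x.
  case: q => q [sq qp] /=; apply: (le_trans _ (sublinearN x sq)).
  by rewrite lerN2.
have [||A Atot|[q [sq qp]] qmin] := @ZL_preorder T (exist _ p0 (conj sp0 (fun x => lexx _))) below.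
- by move=> t; apply/asboolP => x.
- move=> r s t /asboolP rs /asboolP st; apply/asboolP => x.
  exact: le_trans (st x) (rs x).
- have [[q0 Aq0]|A0] := pselect (A !=set0); last first.
    by exists (exist _ p0 (conj sp0 (fun x => lexx _))) => s As; case: A0; exists s.
  pose m x := inf [set sval q x | q in A].
  have mle (q : T) x : A q -> m x <= sval q x.
    move=> Aq; apply: ge_inf; last by exists q.
    by exists (- p0 (- x)) => _ [s /= _ <-].
  have lem c x : (forall q : T, A q -> c <= sval q x) -> c <= m x.
    move=> h; apply: lb_le_inf; first by exists (sval q0 x), q0.
    by move=> _ [q Aq <-]; exact: h.
  have sm : sublinear m.
    split=> [x y|t x t0].
      rewrite -lerBlDr; apply/lem => q Aq; rewrite lerBlDr -lerBlDl.
      apply/lem => r Ar; rewrite lerBlDr.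
      (* The smaller of two members of the chain serves for both summands. *)
      have [/asboolP h|/asboolP h] := Atot _ _ Aq Ar.
        have := (svalP r).1.1 x y; have := h x; have := mle r (x + y) Ar.
        by lra.
      have := (svalP q).1.1 x y; have := h y; have := mle q (x + y) Aq.
      by lra.
    have [->|tn0] := eqVneq t 0.
      rewrite scale0r mul0r; apply: (le_trans (mle q0 0 Aq0)).
      by rewrite sublinear0//; have := (svalP q0).1.
    have tp : 0 < t by rewrite lt_neqAle eq_sym tn0.
    rewrite -ler_pdivrMl//; apply/lem => q Aq; rewrite ler_pdivrMl//.
    exact: le_trans (mle q _ Aq) ((svalP q).1.2 t x t0).
  have mp x : m x <= p0 x by exact: le_trans (mle q0 x Aq0) ((svalP q0).2 x).
  exists (exist _ m (conj sm mp)) => s As; apply/asboolP => x /=; exact: mle.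
exists q.
have lq : scalar q.
  apply: minimal_sublinear => // q' sq' q'q.
  have q'p x : q' x <= p0 x by exact: le_trans (q'q x) (qp x).
  by apply/asboolP/(qmin (exist _ q' (conj sq' q'p)))/asboolP.
have qlep x : q x <= p x.
  apply: (le_trans (qp x)); apply: (le_trans (@infshift_le p x0 x 0 sp _)) => //.
  by rewrite scale0r addr0 mul0r subr0.
split=> //; apply/eqP; rewrite eq_le qlep/=.
(* The choice [t = 1] gives [q (- x0) <= - p x0], hence [p x0 <= q x0]. *)
have := qp (- x0); have := @infshift_le p x0 (- x0) 1 sp ler01.
rewrite scale1r mul1r addNr sublinear0// -/(p0 _).
have := sublinearN (- x0) sq; rewrite opprK; lra.
Qed.

End hahn_banach.

(** * Ultrafilters and weak limits *)

Section ultrafilters.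

Lemma ultra_fmap (T U : Type) (f : T -> U) (F : set_system T) :
  UltraFilter F -> UltraFilter (f @ F).
Proof.
move=> FU; split=> [|G GF FG]; first exact: fmap_proper_filter.
apply/seteqP; split=> // A GA; have [//|FA] := in_ultra_setVsetC (f @^-1` A) FU.
have /FG GnA : (f @ F) (~` A) by [].
by have /filter_ex[x []] : G (A `&` ~` A) by exact: filterI.
Qed.

(** If the preimage of a neighbourhood [B] were not in [F], then [F] traced on its complement would
    be proper and extend to an ultrafilter finer than [F] along which [f] avoids [B]. *)
Lemma cvg_ultra (T : Type) (U : topologicalType) (f : T -> U)
    (F : set_system T) (c : U) : Filter F ->
  (forall G, UltraFilter G -> F `<=` G -> f @ G --> c) -> f @ F --> c.
Proof.
move=> FF h B Bc; apply: contrapT => nFB.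
pose D := ~` (f @^-1` B).
have PD : ProperFilter (within D F).
  split; last exact: within_filter.
  rewrite /within/= => FD; apply: nFB.
  by apply: filterS FD => t /= tD; apply: contrapT => /tD.
have [G [GU DG]] := ultraFilterLemma PD.
have FG : F `<=` G by apply: subset_trans DG; exact: cvg_within.
have GB : G (f @^-1` B) by exact: (h G).
have GD : G D by apply: DG; exact: withinT.
by have /filter_ex[x []] : G (f @^-1` B `&` D) by exact: filterI.
Qed.

Lemma ultra_bounded_cvg (R : realType) (T : Type) (f : T -> R)
    (F : set_system T) (M : R) : UltraFilter F -> (forall t, `|f t| <= M) ->
  cvg (f @ F).
Proof.
move=> FU fM; have := @segment_compact R (- M) M.
rewrite compact_ultra => /(_ _ (ultra_fmap f FU)) h.
have /h[x [_ xF]] : (f @ F) `[- M, M]%classic.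
  by apply: (@filterE _ F) => t /=; rewrite in_itv/= -ler_norml; exact: fM.
by apply: (cvgP x).
Qed.

End ultrafilters.

(** * Continuous linear functionals and reflexivity *)

Section dual_space.
Context {R : realType}.
Implicit Types X Y : normedModType R.

Lemma scalar0 X (l : X -> R) : scalar l -> l 0 = 0.
Proof. by move=> ll; have := ll (-1) 0 0; rewrite scaler0 add0r; lra. Qed.

Lemma scalarN X (l : X -> R) x : scalar l -> l (- x) = - l x.
Proof.
by move=> ll; have := ll (-1) x 0; rewrite scalar0// !addr0 scaleN1r mulN1r.
Qed.

Lemma scalarB X (l : X -> R) x y : scalar l -> l (x - y) = l x - l y.
Proof.
by move=> ll; have := ll 1 x (- y); rewrite scale1r mul1r (scalarN _ ll).
Qed.

Lemma dual_bounded X (l : X -> R) : dual l ->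
  exists2 C : R, 0 < C & forall x, `|l x| <= C * `|x|.
Proof.
move=> [ll cl].
pose f : {linear X -> R^o} :=
  HB.pack (l : X -> R^o) (GRing.isLinear.Build R X R^o *%R l ll).
have /linear_boundedP : bounded_near f (nbhs 0).
  by apply: continuous_linear_bounded; exact: cl.
by move=> /pinfty_ex_gt0[C C0 fC]; exists C.
Qed.

Lemma bounded_dual X (l : X -> R) (C : R) : scalar l ->
  (forall x, `|l x| <= C * `|x|) -> dual l.
Proof.
move=> ll lC; split=> //.
pose f : {linear X -> R^o} :=
  HB.pack (l : X -> R^o) (GRing.isLinear.Build R X R^o *%R l ll).
apply: (@bounded_linear_continuous _ _ _ f); apply/linear_boundedP; near=> r => x.
apply: (le_trans (lC x)); apply: ler_wpM2r => //.
Unshelve. all: by end_near. Qed.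

Lemma dual_normP X (l : X -> R) x : dual l -> `|l x| <= dual_norm l * `|x|.
Proof.
move=> dl; have [C C0 lC] := dual_bounded dl.
have [->|x0] := eqVneq x 0; first by rewrite (scalar0 dl.1) !normr0 mulr0.
have nx : 0 < `|x| by rewrite normr_gt0.
rewrite -ler_pdivrMr//.
have <- : `|l (`|x|^-1 *: x)| = `|l x| / `|x|.
  have := dl.1 `|x|^-1 x 0; rewrite (scalar0 dl.1) !addr0 => ->.
  by rewrite normrM normrV ?unitfE ?gt_eqF// normr_id mulrC.
apply: ub_le_sup; last first.
  exists (`|x|^-1 *: x) => //=.
  by rewrite normrZ normrV ?unitfE ?gt_eqF// normr_id mulVf ?gt_eqF.
exists C => _ [y /= y1 <-]; apply: (le_trans (lC y)).
by rewrite ler_piMr// ltW.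
Qed.

(** Serves twice: with the norm it yields norming functionals, with the distance to a span it yields
    Mazur's argument. *)
Lemma sublinear_dual X (p : X -> R) x0 : sublinear p ->
  (forall x, p x <= `|x|) ->
  exists l, [/\ dual l, forall x, l x <= p x, forall x, `|l x| <= `|x| &
    l x0 = p x0].
Proof.
move=> sp px; have [l [ll lp lx0]] := hahn_banach x0 sp.
have l1 x : `|l x| <= `|x|.
  rewrite ler_norml (le_trans (lp x) (px x)) andbT lerNl -scalarN//.
  by rewrite -[leRHS]normrN (le_trans (lp _) (px _)).
exists l; split=> //; apply: (@bounded_dual _ _ 1) => // x.
by rewrite mul1r.
Qed.

Lemma norming X (x0 : X) :
  exists l, [/\ dual l, forall x, `|l x| <= `|x| & l x0 = `|x0|].
Proof.
have [|//|l [dl _ l1 lx0]] := @sublinear_dual X Num.norm x0; last by exists l.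
by split=> [x y|t x t0]; [exact: ler_normD|rewrite normrZ ger0_norm].
Qed.

Lemma dual_separates X (x y : X) : (forall l, dual l -> l x = l y) -> x = y.
Proof.
move=> xy; have [l [dl _]] := norming (x - y).
rewrite scalarB ?(xy _ dl) ?subrr; last exact: dl.1.
by move=> /esym/eqP; rewrite normr_eq0 subr_eq0 => /eqP.
Qed.

Lemma dual_comp X Y (i : {linear X -> Y}) (l : Y -> R) :
  continuous i -> dual l -> dual (l \o i).
Proof.
move=> ci [ll cl]; split.
  by move=> a x y /=; rewrite linearP ll.
by move=> x; apply: continuous_comp; [exact: ci|exact: cl].
Qed.

(** The limits of [l (u t)] along [F] exist by boundedness and depend linearly and boundedly on [l];
    they form an element of the bidual, which reflexivity represents by a point. *)
Lemma weak_ultra_limit X (T : Type) (u : T -> X) (M : R) (F : set_system T) :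
  reflexive_space X -> UltraFilter F -> (forall t, `|u t| <= M) ->
  exists x, forall l, dual l -> l \o u @ F --> l x.
Proof.
move=> reflX FU uM; pose Phi (l : X -> R) : R := lim (l \o u @ F).
have bd l : dual l -> forall t, `|(l \o u) t| <= dual_norm l * M.
  move=> dl t /=; apply: (le_trans (dual_normP _ dl)).
  apply: ler_wpM2l => //; have := dual_normP (u t) dl.
  have [C C0 lC] := dual_bounded dl.
  (* [dual_norm l] is nonnegative because [0] lies in the unit ball. *)
  move=> _; rewrite /dual_norm; apply: (@le_trans _ _ `|l 0|) => //.
  apply: ub_le_sup; last by exists 0; rewrite //= normr0.
  by exists C => _ [y /= y1 <-]; apply: (le_trans (lC y)); rewrite ler_piMr// ltW.
have cvl l : dual l -> l \o u @ F --> Phi l.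
  by move=> dl; exact: ultra_bounded_cvg (bd _ dl).
have [|x xP] := reflX Phi; last by exists x => l dl; rewrite -xP//; exact: cvl.
split=> [a l m dl dm|].
  apply: cvg_lim => //; apply: cvgD; last exact: cvl.
  by apply: cvgMr; exact: cvl.
exists M => l dl; rewrite mulrC.
apply: (@closed_cvg _ _ F _ (l \o u) [set r | `|r| <= dual_norm l * M]); last exact: cvl.
- rewrite (_ : [set _ | _] = Num.norm @^-1` [set r | r <= dual_norm l * M])//.
  by apply: closed_comp => [r _|]; [exact: norm_continuous|exact: closed_le].
- by apply: nearW => t; exact: bd.
Qed.

End dual_space.

(** * Weak sequential compactness and embeddings *)

Section weak_compactness.
Context {R : realType} {X : normedModType R}.
Implicit Types (x : X) (s : seq (R * nat)).

Section span.
Variable u : nat -> X.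

(** Lists of coefficient-index pairs encode the span: concatenation adds combinations, and lists
    with rational coefficients can be numbered by [pickle]. *)
Definition comb s : X := \sum_(a <- s) a.1 *: u a.2.

Definition dist_span x : R := inf [set `|x - comb s| | s in setT].

Lemma dist_span_le x s : dist_span x <= `|x - comb s|.
Proof.
apply: ge_inf; last by exists s.
by exists 0 => _ [r _ <-].
Qed.

Lemma le_dist_span x c : (forall s, c <= `|x - comb s|) -> c <= dist_span x.
Proof.
move=> h; apply: lb_le_inf; first by exists `|x - comb [::]|, [::].
by move=> _ [s _ <-].
Qed.

Lemma dist_span_norm x : dist_span x <= `|x|.
Proof. by have := dist_span_le x [::]; rewrite /comb big_nil subr0. Qed.

Lemma dist_span_eq0 a n : dist_span (a *: u n) <= 0.
Proof.
have := dist_span_le (a *: u n) [:: (a, n)].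
by rewrite /comb big_seq1/= subrr normr0.
Qed.

Lemma combZ t s : comb [seq (t * a.1, a.2) | a <- s] = t *: comb s.
Proof.
rewrite /comb big_map scaler_sumr; apply: eq_bigr => a _ /=.
by rewrite scalerA.
Qed.

Lemma dist_span_sublinear : sublinear dist_span.
Proof.
split=> [x y|t x].
  rewrite -lerBlDr; apply: le_dist_span => s; rewrite lerBlDr -lerBlDl.
  apply: le_dist_span => r; rewrite lerBlDr.
  apply: (le_trans (dist_span_le _ (s ++ r))).
  rewrite /comb big_cat/= opprD addrACA addrC.
  exact: ler_normD.
rewrite le_eqVlt => /predU1P[<-|t0].
  by rewrite scale0r mul0r; have := dist_span_norm 0; rewrite normr0.
rewrite -ler_pdivrMl//; apply: le_dist_span => s; rewrite ler_pdivrMl//.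
apply: (le_trans (dist_span_le _ [seq (t * a.1, a.2) | a <- s])).
by rewrite combZ -scalerBr normrZ gtr0_norm.
Qed.

Lemma comb_rat s e : 0 < e ->
  exists q : seq (rat * nat), `|comb s - comb [seq (ratr a.1, a.2) | a <- q]| < e.
Proof.
elim: s e => [|[a n] s IHs] e e0.
  by exists [::]; rewrite /comb !big_nil subrr normr0.
have e2 : 0 < e / 2 by rewrite divr_gt0.
have [q sq] := IHs _ e2.
(* The added 1 keeps the divisor positive when [u n] is zero. *)
pose d := e / 2 / (`|u n| + 1).
have d0 : 0 < d by rewrite divr_gt0// ltr_wpDl.
have [b] : exists b : rat, ratr b \in `]a - d, a + d[.
  by apply: rat_in_itvoo; rewrite ltrD2l gtrN.
rewrite in_itv/= => /andP[b1 b2].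
exists ((b, n) :: q); rewrite /comb /= !big_cons/= -!/(comb _).
rewrite opprD addrACA -scalerBl (splitr e).
apply: (le_lt_trans (ler_normD _ _)); apply: ltrD => //.
have ab : `|a - ratr b| < d by rewrite ltr_norml; apply/andP; split; lra.
rewrite normrZ; apply: (@le_lt_trans _ _ (`|a - ratr b| * (`|u n| + 1))).
  by apply: ler_wpM2l => //; rewrite lerDl.
by rewrite -ltr_pdivlMr// ltr_wpDl.
Qed.

(* Mazur: a functional dominated by [dist_span] vanishes on the span, hence at
   weak limits of its elements. *)
Lemma weak_limits_dist (T : Type) (n_ : T -> nat) (F : set_system T) x x' e :
  ProperFilter F ->
  (exists G : set_system nat, ProperFilter G /\
    forall l, dual l -> l \o u @ G --> l x) ->
  (forall l, dual l -> l \o u \o n_ @ F --> l x') ->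
  0 < e -> exists s, `|x' - x - comb s| < e.
Proof.
move=> PF [G [PG Gx]] Fx' e0.
have [l [dl ld _ lx]] :=
  sublinear_dual (x' - x) dist_span_sublinear dist_span_norm.
have lu n : l (u n) = 0.
  apply/eqP; rewrite eq_le; apply/andP; split.
    by apply: (le_trans (ld _)); have := dist_span_eq0 1 n; rewrite scale1r.
  rewrite -oppr_le0 -(scalarN _ dl.1); apply: (le_trans (ld _)).
  by have := dist_span_eq0 (-1) n; rewrite scaleN1r.
have lx0 : l x = 0.
  apply: (cvg_unique _ (Gx l dl)) => //.
  by rewrite (_ : l \o u = cst 0); [exact: cvg_cst|apply/funext => n /=].
have lx'0 : l x' = 0.
  apply: (cvg_unique _ (Fx' l dl)) => //.
  by rewrite (_ : l \o u \o n_ = cst 0); [exact: cvg_cst|apply/funext => n /=].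
(* If no combination came within [e], the distance of [x' - x] to the span, which is
   [l (x' - x) = 0], would be at least [e]. *)
apply: contrapT => /forallNP h.
have : e <= dist_span (x' - x).
  by apply: le_dist_span => s; rewrite leNgt; apply/negP/h.
by rewrite -lx (scalarB _ _ dl.1) lx0 lx'0 subrr leNgt e0.
Qed.

End span.

(* Eberlein-Smulian: countably many norming functionals separate the points of
   the closed span of [u], so a subsequence along which they converge to their
   values at a weak cluster point [x] has [x] as its only weak cluster point. *)
Lemma weak_subsequence (u : nat -> X) (M : R) (F : set_system nat) x :
  reflexive_space X -> (forall n, `|u n| <= M) ->
  UltraFilter F -> \oo `<=` F ->
  (forall l, dual l -> l \o u @ F --> l x) ->
  exists2 n_ : nat -> nat, forall k, (k <= n_ k)%N & weak_cvg (u \o n_) x.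
Proof.
move=> reflX uM FU ooF Fx.
pose combq (q : seq (rat * nat)) := comb u [seq (ratr a.1, a.2) | a <- q].
have [lf lfP] := choice (fun q => norming (combq q)).
(* A numbering of the countable family [lf]; codes that decode to nothing fall back to the empty
   combination. *)
pose L (j : nat) := lf (odflt [::] (unpickle j)).
have LP q : L (pickle q) = lf q by rewrite /L pickleK.
(* Diagonal choice: the [k]-th term matches [x] on the first [k.+1] functionals up to [k.+1%:R^-1],
   so every [L j] converges along the subsequence. *)
have step k : exists n, (k <= n)%N /\
    forall j : 'I_k.+1, `|L j x - L j (u n)| < k.+1%:R^-1.
  have H1 : F [set n | (k <= n)%N] by apply: ooF; exact: nbhs_infty_ge.
  have H2 : F [set n | forall j : 'I_k.+1, `|L j x - L j (u n)| < k.+1%:R^-1].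
    apply: (@filter_forall _ _ (fun (j : 'I_k.+1) n =>
      `|L j x - L j (u n)| < k.+1%:R^-1) F) => j.
    have [dl _ _] := lfP (odflt [::] (unpickle j)).
    by have /cvgrPdist_lt := Fx _ dl; apply; rewrite invr_gt0.
  have /filter_ex[n []] : F ([set n | (k <= n)%N] `&`
      [set n | forall j : 'I_k.+1, `|L j x - L j (u n)| < k.+1%:R^-1]).
    exact: filterI.
  by exists n.
have [n_ n_P] := choice step.
exists n_ => [k|l dl]; first by case: (n_P k).
have n_L j : L j \o u \o n_ @ \oo --> L j x.
  apply/cvgrPdist_lt => e e0; near=> k.
  have jk : (j < k.+1)%N by near: k; exact: nbhs_infty_ge.
  have [_ /(_ (Ordinal jk)) /= h] := n_P k; apply: (lt_trans h).
  by near: k; exact: near_infty_natSinv_lt (PosNum e0).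
apply: cvg_ultra => G GU ooG.
have [x' Gx'] := weak_ultra_limit reflX GU (fun k => uM (n_ k)).
suff -> : x = x' by exact: Gx'.
apply/eqP; rewrite eq_sym -subr_eq0 -normr_le0; apply/ler_addgt0Pr => e e0; rewrite add0r.
have e4 : 0 < e / 4 by rewrite divr_gt0.
(* By Mazur, [x' - x] is within [e / 2] of a rational combination. Its norming functional [lf q]
   vanishes on [x' - x], so the combination itself has norm below [e / 2]. *)
have [s xs] := weak_limits_dist _ (ex_intro _ F (conj _ Fx)) Gx' e4.
have [q sq] := comb_rat u s e4.
have [[ll _] l1 lq] := lfP q.
have lx : lf q x = lf q x'.
  rewrite -LP; apply: (cvg_unique _ _ (Gx' _ _)) => //; last first.
    by rewrite LP; have [] := lfP q.
  exact: cvg_trans (cvg_app _ ooG) (n_L _).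
have h1 : `|x' - x - combq q| < e / 2.
  rewrite (_ : _ - _ = (x' - x - comb u s) + (comb u s - combq q)); last first.
    by rewrite addrA subrK.
  by apply: (le_lt_trans (ler_normD _ _)); rewrite /combq; lra.
have h2 : `|combq q| < e / 2.
  apply: le_lt_trans h1; rewrite -lq -[leRHS]normrN; apply: le_trans (l1 _).
  by rewrite opprB !(scalarB _ _ ll) lx subrr subr0 ler_norm.
rewrite -(subrK (combq q) (x' - x)); apply: (le_trans (ler_normD _ _)).
by lra.
Unshelve. all: by end_near. Qed.

(** Compactness gives a limit in [Y] along every ultrafilter, and functionals on [Y] pulled back
    along [i] identify it with [i x]. *)
Lemma weak_cvg_compact (Y : normedModType R) (i : {linear X -> Y})
    (u : nat -> X) x : compact_embedding i -> bounded_set (range u) ->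
  weak_cvg u x -> i (u n) @[n --> \oo] --> i x.
Proof.
move=> [[_ ci] ki] bu ux; apply: (@cvg_ultra _ _ (i \o u)) => G GU ooG.
have := ki _ bu; rewrite precompactE compact_ultra.
move=> /(_ _ (ultra_fmap (i \o u) GU)) h.
have /h[y [_ Gy]] : ((i \o u) @ G) (closure (i @` range u)).
  by apply: (@filterE _ G) => n /=; apply: subset_closure; exists (u n) => //; exists n.
suff -> : i x = y by [].
apply: dual_separates => l dl.
apply: (@cvg_unique _ _ (l \o (i \o u) @ G)) => //.
  exact: cvg_trans (cvg_app _ ooG) (ux _ (dual_comp ci dl)).
apply: (@cvg_comp _ _ _ (i \o u) l G (nbhs y)) => //; exact: dl.2.
Qed.

(** Reflexivity gives a weak limit along every ultrafilter; its image must be [i x], and injectivity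
    of [i] finishes. *)
Lemma weak_cvg_embedding (Y : normedModType R) (i : {linear X -> Y})
    (u : nat -> X) (M : R) x : reflexive_space X -> embedding i ->
  (forall n, `|u n| <= M) -> i (u n) @[n --> \oo] --> i x -> weak_cvg u x.
Proof.
move=> reflX [inji ci] uM ux l dl; apply: cvg_ultra => G GU ooG.
have [x' Gx'] := weak_ultra_limit reflX GU uM.
suff -> : x = x' by exact: Gx'.
apply: inji; apply: dual_separates => m dm.
apply: (@cvg_unique _ _ (m \o (i \o u) @ G)) => //; last exact: (Gx' _ (dual_comp ci dm)).
apply: (@cvg_comp _ _ _ (i \o u) m G (nbhs (i x))); last exact: dm.2.
exact: cvg_trans (cvg_app _ ooG) ux.
Qed.

End weak_compactness.

(** * Existence of minimizers *)

Section minimization.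
Context {R : realType}.

Lemma limn_einf_gt (u : nat -> \bar R) (c : \bar R) :
  (c < limn_einf u)%E -> \forall n \near \oo, (c < u n)%E.
Proof.
move=> cu; have [n cn] : exists n, (c < einfs u n)%E.
  apply: contrapT => /forallNP h; move: cu; apply/negP; rewrite -leNgt.
  rewrite limn_einf_lim; apply: lime_le; first exact: is_cvg_einfs.
  by apply: nearW => n; rewrite leNgt; apply/negP/h.
exists n => // m /= nm; apply: (lt_le_trans cn).
by apply: ereal_inf_lbound; exists m.
Qed.

(** The norming functional of [x - y] transfers the bound; this is weak lower semicontinuity of the
    norm. *)
Lemma weak_cvg_norm_gt (X : normedModType R) (u : nat -> X) (x y : X) (c : R) :
  weak_cvg u x -> c < `|x - y| -> \forall n \near \oo, c < `|u n - y|.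
Proof.
move=> ux cx; have [l [dl l1 lx]] := norming (x - y).
have lu : l (u n) - l y @[n --> \oo] --> l x - l y.
  by apply: cvgB; [exact: ux|exact: cvg_cst].
rewrite -lx (scalarB _ _ dl.1) in cx.
near=> n; apply: (@lt_le_trans _ _ (l (u n) - l y)).
  by near: n; exact: cvgr_gt lu _ cx.
by rewrite -(scalarB _ _ dl.1); apply: le_trans (l1 _); exact: ler_norm.
Unshelve. all: by end_near. Qed.

Lemma coercive_bounded (X : normedModType R) (Reg : X -> \bar R) (K : R) :
  (forall M : R, exists rho : R, forall f, rho <= `|f| -> (M%:E <= Reg f)%E) ->
  exists rho : R, forall f, (Reg f <= K%:E)%E -> `|f| <= rho.
Proof.
move=> /(_ (K + 1))[rho h]; exists rho => f fK; rewrite leNgt; apply/negP => rf.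
by have := le_trans (h _ (ltW rf)) fK; rewrite lee_fin; lra.
Qed.

Lemma minimizer_exists (X X0 Y : normedModType R) (i : {linear X -> X0})
    (S : set X) (T : X -> Y) (y : Y) (b : R) (Reg : X -> \bar R) :
  reflexive_space X -> embedding i -> compact (i @` S) -> 0 < b ->
  (forall (fm : nat -> X) (f : X), weak_cvg fm f ->
     (exists M : R, forall m, `|fm m| <= M) ->
     weak_cvg (fun m => T (fm m)) (T f)) ->
  (forall f, (0 <= Reg f)%E) ->
  (forall (fm : nat -> X) (f : X), weak_cvg fm f ->
     (Reg f <= limn_einf (fun m => Reg (fm m)))%E) ->
  (forall M : R, exists rho : R, forall f, rho <= `|f| -> (M%:E <= Reg f)%E) ->
  (exists2 f, S f & (Reg f < +oo)%E) ->
  exists f, minimizer S (fun f => `|T f - y|%:E + b%:E * Reg f)%E f.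
Proof.
move=> reflX ei ki b0 Tc Reg0 Rlsc Rcoer [f0 Sf0 Rf0].
set J := fun f => (`|T f - y|%:E + b%:E * Reg f)%E.
have J0 f : (0 <= J f)%E.
  by rewrite adde_ge0 ?lee_fin// mule_ge0 ?lee_fin// ltW.
pose m := ereal_inf (J @` S).
have m_le f : S f -> (m <= J f)%E by move=> Sf; apply: ereal_inf_lbound; exists f.
have m_ge0 : (0 <= m)%E by apply: le_ereal_inf_tmp => _ [f _ <-].
have mfin : m \is a fin_num.
  rewrite ge0_fin_numE//; apply: (le_lt_trans (m_le _ Sf0)).
  by rewrite lte_add_pinfty ?ltry// lte_mul_pinfty// ?lee_fin ?ltW// ltry.
pose m0 := fine m; have mE : m = m0%:E by rewrite fineK.
pose D (e : R) := [set f | S f /\ (J f < (m0 + e)%:E)%E].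
have Dex e : 0 < e -> exists f, D e f.
  move=> e0; have [_ [f Sf <-] Jf] := lb_ereal_inf_adherent e0 mfin.
  by exists f; split=> //; rewrite EFinD -mE.
pose F := filter_from [set e : R | 0 < e] (fun e => i @` D e).
have PF : ProperFilter F.
  apply: filter_from_proper; last by move=> e /Dex[f Df]; exists (i f), f.
  apply: filter_from_filter; first by exists 1 => /=.
  move=> e e' /= e0 e'0; exists (Num.min e e') => /=; first by rewrite lt_min e0.
  move=> _ [f [Sf Jf] <-]; split; exists f => //; split=> //; apply: (lt_le_trans Jf).
    by rewrite lee_fin lerD2l ge_min lexx.
  by rewrite lee_fin lerD2l ge_min lexx orbT.
have [_ [[f Sf <-] clF]] : i @` S `&` cluster F !=set0.
  by apply: ki; exists 1 => //= _ [f [Sf _] <-]; exists f.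
(* Near-minimizers are picked in shrinking balls around the cluster point, giving a minimizing
   sequence that converges in [X0]. *)
have step (n : nat) : exists h, [/\ S h, (J h < (m0 + n.+1%:R^-1)%:E)%E &
    `|i f - i h| < n.+1%:R^-1].
  have n0 : 0 < n.+1%:R^-1 :> R by rewrite invr_gt0.
  have FD : F (i @` D n.+1%:R^-1) by exists n.+1%:R^-1.
  have [_ [[h [Sh Jh] <-] fh]] := clF _ _ FD (nbhsx_ballx (i f) _ n0).
  by exists h; split=> //; move: fh; rewrite -ball_normE.
have [h hP] := choice step.
(* Every term has objective at most [m0 + 1], and dividing by the positive weight bounds [Reg]. *)
pose K := (m0 + 1) / b.
have hK n : (Reg (h n) <= K%:E)%E.
  have [_ Jh _] := hP n.
  have : (b%:E * Reg (h n) <= (m0 + 1)%:E)%E.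
    apply: (@le_trans _ _ (J (h n))); first by rewrite leeDr// lee_fin.
    apply: (le_trans (ltW Jh)); rewrite lee_fin lerD2l.
    by rewrite invf_le1// ler1n.
  by rewrite -lee_pdivlMl// -EFinM mulrC.
have [rho hrho] := coercive_bounded K Rcoer.
have hM n : `|h n| <= rho by exact: hrho.
have hi : i (h n) @[n --> \oo] --> i f.
  apply/cvgrPdist_lt => e e0; near=> n.
  have [_ _ /lt_trans] := hP n; apply.
  by near: n; exact: near_infty_natSinv_lt (PosNum e0).
have hf := weak_cvg_embedding reflX ei hM hi.
have RfK : (Reg f <= K%:E)%E.
  apply: (le_trans (Rlsc _ _ hf)); rewrite leNgt; apply/negP => /limn_einf_gt[n _ hn].
  by have := hn n (leqnn n); rewrite ltNge hK.
have fin g : (Reg g <= K%:E)%E -> Reg g = (fine (Reg g))%:E.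
  by move=> gK; rewrite fineK// ge0_fin_numE//; apply: le_lt_trans gK _; rewrite ltry.
exists f; split=> // g Sg; apply: le_trans (m_le _ Sg); rewrite mE.
rewrite /J fin// -EFinM -EFinD lee_fin; apply/ler_addgt0Pr => e e0.
(* The losses are [d] in the residual, [b * d] in the penalty and [d] from near-minimality, in total
   [e]. *)
pose d := e / (2 + b).
have d0 : 0 < d by rewrite divr_gt0// addr_gt0.
have [n [h1 h2 h3]] : exists n, [/\ `|T f - y| - d < `|T (h n) - y|,
    ((fine (Reg f) - d)%:E < Reg (h n))%E & n.+1%:R^-1 < d].
  have [] := @filter_ex _ (\oo : set_system nat) _
    [set n | [/\ `|T f - y| - d < `|T (h n) - y|,
    ((fine (Reg f) - d)%:E < Reg (h n))%E & n.+1%:R^-1 < d]]; last by move=> n; exists n.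
  near=> n; split; near: n.
  - apply: weak_cvg_norm_gt; first exact: (Tc _ _ hf (ex_intro _ rho hM)).
    by rewrite ltrBlDr ltrDl.
  - apply: limn_einf_gt; apply: lt_le_trans (Rlsc _ _ hf).
    by rewrite [ltRHS]fin// lte_fin ltrBlDr ltrDl.
  - exact: near_infty_natSinv_lt (PosNum d0).
have [_ Jh _] := hP n.
move: Jh; rewrite /J (fin _ (hK n)) -EFinM -EFinD lte_fin => Jh.
rewrite (fin _ (hK n)) lte_fin in h2.
have h2b : b * (fine (Reg f) - d) <= b * fine (Reg (h n)) by rewrite ler_pM2l// ltW.
have -> : e = d * (2 + b) by rewrite divfK// gt_eqF// addr_gt0.
rewrite mulrBr in h2b; rewrite mulrDr; move: (n.+1%:R^-1) h3 Jh => z h3 Jh.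
by lra.
Unshelve. all: by end_near. Qed.

End minimization.

(** * Convergence, schedules and error levels *)

Section convergence.
Context {R : realType}.

Lemma cvg_subseq (n_ : nat -> nat) : (forall k, (k <= n_ k)%N) -> n_ @ \oo --> \oo.
Proof.
by move=> kn A [N _ NA]; exists N => // k Nk; apply: NA; exact: leq_trans (kn k).
Qed.

(** Each ultrafilter limit is reached by a subsequence, along which weak continuity shows that it
    solves [T f = g]; hence it is [x]. *)
Lemma weak_cvg_unique_solution (X Y : normedModType R) (T : X -> Y) (g : Y)
    (x : X) (u : nat -> X) (M : R) :
  reflexive_space X ->
  (forall (fm : nat -> X) (f : X), weak_cvg fm f ->
     (exists M : R, forall m, `|fm m| <= M) ->
     weak_cvg (fun m => T (fm m)) (T f)) ->
  (forall f, T f = g -> f = x) ->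
  (forall n, `|u n| <= M) -> T (u n) @[n --> \oo] --> g -> weak_cvg u x.
Proof.
move=> reflX Tc Tx uM Tu l dl; apply: (@cvg_ultra _ _ (l \o u)) => G GU ooG.
have [x' Gx'] := weak_ultra_limit reflX GU uM.
suff -> : x = x' by exact: Gx'.
have [n_ kn ux'] := weak_subsequence reflX uM GU ooG Gx'.
apply/esym/Tx; apply: dual_separates => m dm.
have uM' : exists M : R, forall k, `|(u \o n_) k| <= M.
  by exists M => k; exact: uM.
apply: (cvg_unique _ (Tc _ _ ux' uM' _ dm)) => //.
apply: (@cvg_comp _ _ _ (T \o u \o n_) m \oo (nbhs g)); last exact: dm.2.
exact: (@cvg_comp _ _ _ n_ (T \o u) _ _ _ (cvg_subseq kn) Tu).
Qed.

End convergence.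

Section first_index.

Lemma ex_first_at (P : nat -> Prop) k : (0 < k)%N -> P k -> exists i, first_at P i.
Proof.
move=> k0 Pk; have ex : exists i, (0 < i)%N && `[< P i >].
  by exists k; rewrite k0; exact/asboolP.
have [i /andP[i0 /asboolP Pi] imin] := ex_minnP ex; exists i; split=> // j.
move=> /andP[j0 ji] Pj; have := imin j; rewrite j0/= leqNgt ji.
by move=> h; have := h (introT (asboolP _) Pj).
Qed.

Lemma first_at_le (P : nat -> Prop) i k :
  first_at P i -> (0 < k)%N -> P k -> (i <= k)%N.
Proof.
by move=> [_ _ h] k0 Pk; rewrite leqNgt; apply/negP => ki; apply: (h k); rewrite ?k0.
Qed.

Lemma first_indexP (P : nat -> Prop) k : (0 < k)%N -> P k ->
  first_at P (first_index P).
Proof. by move=> k0 /(ex_first_at k0); exact: xgetPex. Qed.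

End first_index.

(** * Expansion schedules and scaling of the error levels *)

Section schedules.
Context {R : realType}.

(** With [c <= 1] the schedule could never exceed [s 1]. *)
Lemma growth_gt1 (s : nat -> nat) (c : R) :
  (forall M, exists2 k, (0 < k)%N & (M <= s k)%N) ->
  (forall k, (0 < k)%N -> (s k.+1)%:R <= c * (s k)%:R) -> 1 < c.
Proof.
move=> sunb sc; rewrite ltNge; apply/negP => c1.
have s1 k : (s k.+1 <= s 1)%N.
  elim: k => // k IHk; apply: leq_trans IHk; rewrite -(ler_nat R).
  by apply: (le_trans (sc _ _)) => //; rewrite ler_piMl.
by have [[//|k] _] := sunb (s 1%N).+1; rewrite ltnNge s1.
Qed.

(** If [kn] is 1 the value is [s 1]; otherwise the preceding value is below [n] and one growth step
    gives at most [c * n]. Freezing carries this value to [K]. *)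
Lemma schedule_target (s : nat -> nat) (c : R) (n K : nat) :
  (forall M, exists2 k, (0 < k)%N & (M <= s k)%N) -> 0 <= c ->
  (forall k, (0 < k)%N -> (s k.+1)%:R <= c * (s k)%:R) ->
  let kn := first_index (fun k => n <= s k)%N in
  (forall k, (kn <= k <= K)%N -> s k = s kn) -> (kn <= K)%N ->
  [/\ (0 < kn)%N, (n <= s K)%N & (s K)%:R <= Num.max (s 1%N)%:R (c * n%:R)].
Proof.
move=> sunb c0 sc kn sfrozen knK; have [k0 k0_gt0 nk0] := sunb n.
have [kn0 nkn knmin] := @first_indexP (fun k => n <= s k)%N k0 k0_gt0 nk0.
rewrite -/kn in kn0 nkn knmin.
have -> : s K = s kn by apply: sfrozen; rewrite knK leqnn.
split=> //; case: kn kn0 knmin {sfrozen knK nkn} => [//|[|k]] _ knmin.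
  by rewrite le_max lexx.
rewrite le_max; apply/orP; right; apply: (le_trans (sc _ _)) => //.
rewrite ler_wpM2l// ler_nat ltnW// ltnNge; apply/negP.
by apply: knmin; rewrite ltnS leqnn.
Qed.

Lemma nat_ceil_ge (x : R) : 0 <= x -> x <= (nat_ceil x)%:R.
Proof.
move=> x0; rewrite /nat_ceil natr_absz ger0_norm ?ceil_ge//.
by rewrite -(@ler_int R) (le_trans x0)// ceil_ge.
Qed.

(** The index map of the scaling condition; for [c > 1] it raises every positive index by at least
    1, so its iterates pass any given index. *)
Definition scaling_step (c : R) (n : nat) := nat_ceil (c * n%:R).

Lemma iter_scaling_ge (c : R) (n p : nat) : 1 < c -> (0 < n)%N ->
  (n + p <= iter p (scaling_step c) n)%N.
Proof.
move=> c1 n0; elim: p => [|p IHp]; first by rewrite addn0.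
have i0 : (0 < iter p (scaling_step c) n)%N by rewrite (leq_trans _ IHp)// addn_gt0 n0.
rewrite addnS; apply: (leq_ltn_trans IHp); rewrite -(ltr_nat R) iterS.
have cge : 0 <= c * (iter p (scaling_step c) n)%:R by rewrite mulr_ge0// ltW// (lt_trans _ c1).
by apply: lt_le_trans (nat_ceil_ge cge); rewrite ltr_pMl ?ltr0n.
Qed.

(** The number of steps depends on [a], which will be a first schedule value, but not on [n]; this
    makes the later lower bounds uniform in the noise level. *)
Lemma le_iter_scaling (c : R) (n p a : nat) : 1 < c -> (0 < n)%N -> (a <= p)%N ->
  forall m : nat, m%:R <= Num.max a%:R (c * n%:R) ->
  (m <= iter p.+1 (scaling_step c) n)%N.
Proof.
move=> c1 n0 ap m; rewrite le_max ler_nat => /orP[ma|mcn].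
  apply: leq_trans (iter_scaling_ge _ c1 n0).
  by rewrite addnS ltnW// ltnS (leq_trans ma)// (leq_trans ap)// leq_addl.
have cge (k : nat) : 0 <= c * k%:R by rewrite mulr_ge0// ltW// (lt_trans _ c1).
rewrite -(ler_nat R) iterS; apply: le_trans (nat_ceil_ge (cge _)).
apply: (le_trans mcn); rewrite ler_pM2l ?(lt_trans _ c1)// ler_nat.
by apply: leq_trans (iter_scaling_ge _ c1 n0); exact: leq_addr.
Qed.

(** Each scaling step costs a factor [q], and monotonicity then passes to the smaller indices. *)
Lemma error_scaling (Nmin Lmin : nat) (E : nat -> nat -> R) (CN CL q : R) :
  (0 < Nmin)%N -> (0 < Lmin)%N -> 1 < CN -> 1 < CL -> 0 < q ->
  (forall N N' L L', (Nmin <= N <= N')%N -> (Lmin <= L <= L')%N ->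
     E N' L' <= E N L) ->
  (forall N L, (Nmin <= N)%N -> (Lmin <= L)%N ->
     q * E N L <= E (nat_ceil (CN * N%:R)) (nat_ceil (CL * L%:R))) ->
  forall p N L N' L', (Nmin <= N)%N -> (Lmin <= L)%N ->
  (Nmin <= N' <= iter p (scaling_step CN) N)%N ->
  (Lmin <= L' <= iter p (scaling_step CL) L)%N -> q ^+ p * E N L <= E N' L'.
Proof.
move=> Nmin0 Lmin0 CN1 CL1 q0 Emono Escal p N L N' L' NN LL NN' LL'.
apply: le_trans (Emono _ _ _ _ NN' LL'); elim: p {N' L' NN' LL'} => [|p IHp].
  by rewrite expr0 mul1r.
rewrite exprS -mulrA 2!iterS.
apply: (@le_trans _ _ (q * E (iter p (scaling_step CN) N) (iter p (scaling_step CL) L))).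
  by rewrite ler_pM2l.
apply: Escal.
- apply: leq_trans (iter_scaling_ge _ CN1 (leq_trans Nmin0 NN)).
  exact: leq_trans (leq_addr _ _).
- apply: leq_trans (iter_scaling_ge _ CL1 (leq_trans Lmin0 LL)).
  exact: leq_trans (leq_addr _ _).
Qed.

End schedules.

(** * The target error level as a function of the noise *)

Section target_error.
Context {R : realType} (tau LA c0 C theta eta : R).
Hypotheses (tau_gt1 : 1 < tau) (LA_gt0 : 0 < LA) (c0_gt0 : 0 < c0)
  (C_gt0 : 0 < C) (theta_gt0 : 0 < theta) (eta_gt0 : 0 < eta).

Let te := target_error tau LA c0 C theta eta.

Let powRK (a : R) : 0 <= a -> (a `^ theta^-1) `^ theta = a.
Proof. by move=> a0; rewrite -powRrM mulVf ?gt_eqF// powRr1. Qed.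

Let coef (k : R) : 0 < k -> 0 < (tau - 1) / k.
Proof. by move=> k0; rewrite divr_gt0// subr_gt0. Qed.

Let kLA : 0 < 2 * LA. Proof. by rewrite mulr_gt0. Qed.
Let kC : 0 < 2 * c0 * C. Proof. by rewrite !mulr_gt0. Qed.

Lemma target_error_gt0 delta : 0 < delta -> 0 < te delta.
Proof.
by move=> d0; rewrite /te /target_error !lt_min eta_gt0 !powR_gt0// mulr_gt0// coef.
Qed.

Lemma target_error_le_eta delta : te delta <= eta.
Proof. by rewrite /te /target_error !ge_min lexx !orbT. Qed.

(** The first two entries of the minimum each account for half of [(tau - 1) * delta]. *)
Lemma target_error_bound delta e : 0 < delta -> 0 <= e -> e <= te delta ->
  LA * e `^ theta + c0 * e `^ theta * C <= (tau - 1) * delta.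
Proof.
move=> d0 e0; rewrite /te /target_error !le_min => /andP[e1 /andP[e2 _]].
have h k : 0 < k -> e <= ((tau - 1) / k * delta) `^ theta^-1 ->
    e `^ theta <= (tau - 1) / k * delta.
  move=> k0 ek; have a0 : 0 <= (tau - 1) / k * delta by rewrite ltW// mulr_gt0// coef.
  by rewrite -[leRHS]powRK// ge0_ler_powR// ?ltW// nnegrE// powR_ge0.
have h1 : LA * e `^ theta <= (tau - 1) * delta / 2.
  rewrite -ler_pdivlMl//; apply: (le_trans (h _ kLA e1)).
  by rewrite le_eqVlt; apply/orP; left; apply/eqP; field; rewrite gt_eqF.
have h2 : c0 * e `^ theta * C <= (tau - 1) * delta / 2.
  rewrite -ler_pdivlMr// -ler_pdivlMl//; apply: (le_trans (h _ kC e2)).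
  by rewrite le_eqVlt; apply/orP; left; apply/eqP; field; rewrite !gt_eqF.
lra.
Qed.

(** Two entries of the minimum, raised to [theta], are proportional to [delta]; the constant entry
    [eta] is compared with [delta] through [delta <= D]. *)
Lemma target_error_lower (D : R) : 0 < D -> exists2 kappa, 0 < kappa &
  forall delta, 0 < delta <= D -> kappa * delta <= te delta `^ theta.
Proof.
move=> D0; pose kappa := Num.min ((tau - 1) / (2 * LA))
  (Num.min ((tau - 1) / (2 * c0 * C)) (eta `^ theta / D)).
have k0 : 0 < kappa by rewrite !lt_min !coef//= divr_gt0// powR_gt0.
exists kappa => // delta /andP[d0 dD].
have kd0 : 0 <= kappa * delta by rewrite mulr_ge0// ltW.
have te0 : 0 < te delta by exact: target_error_gt0.
rewrite -[leLHS]powRK//; apply: ge0_ler_powR;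
  rewrite ?nnegrE ?powR_ge0 ?(ltW theta_gt0) ?(ltW te0)//.
have h k : kappa <= (tau - 1) / k ->
    (kappa * delta) `^ theta^-1 <= ((tau - 1) / k * delta) `^ theta^-1.
  move=> kk; have kkd : kappa * delta <= (tau - 1) / k * delta by rewrite ler_pM2r.
  by apply: ge0_ler_powR; rewrite ?nnegrE ?invr_ge0 ?(ltW theta_gt0) ?(le_trans kd0).
rewrite /te /target_error !le_min !h ?ge_min ?lexx ?orbT//=.
(* [eta] is written as a power with exponent [theta^-1], so that monotonicity of that power
   applies. *)
rewrite -[leRHS](@powRr1 _ eta) ?(ltW eta_gt0)// -(@mulfV _ theta) ?gt_eqF// powRrM.
apply: ge0_ler_powR; rewrite ?nnegrE ?invr_ge0 ?powR_ge0 ?(ltW theta_gt0)//.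
have kD : kappa <= eta `^ theta / D by rewrite !ge_min lexx !orbT.
apply: (@le_trans _ _ (kappa * D)); first by rewrite ler_pM2l.
by rewrite -ler_pdivlMr.
Qed.

End target_error.

(** * The regularization method *)

Section networks_in.
Context {R : realType} (d : nat) (Omega : set 'cV[R]_d).
Variables (sigma : R -> R) (pnorm : forall ws, @params R d ws -> R).

Lemma networks_in_mono (X : normedModType R) (fX : function_space Omega X)
    (N L : nat) (r r' : R) : r <= r' ->
  networks_in fX sigma pnorm N L r `<=` networks_in fX sigma pnorm N L r'.
Proof.
move=> rr' f [phi [ws [th [h1 h2 h3 h4]]] rep]; exists phi => //.
by exists ws, th; split=> //; exact: le_trans rr'.
Qed.

(** Transfers compactness, assumed for the class in [X0], to the image of the class in [X1]; a
    function determines the element it represents. *)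
Lemma image_networks_in (X X' : normedModType R) (fX : function_space Omega X)
    (fX' : function_space Omega X') (i : {linear X -> X'}) (N L : nat) (r : R) :
  function_embedding fX fX' i ->
  (forall phi, networks sigma pnorm N L r phi ->
     exists f, represents fX f (fun t : Omega => phi (val t))) ->
  i @` networks_in fX sigma pnorm N L r = networks_in fX' sigma pnorm N L r.
Proof.
move=> [_ irep] exX; apply/seteqP; split=> [_ [f [phi nphi rep] <-]|f' [phi nphi rep]].
  by exists phi => //; exact: irep.
have [f frep] := exX _ nphi; exists f; first by exists phi.
exact: represents_inj (irep _ _ frep) rep.
Qed.

End networks_in.

Theorem theorem3 (R : realType)
  (* network classes *)
  (d : nat) (d_gt0 : (0 < d)%N) (Omega : set 'cV[R]_d)
  (Omega_open : open Omega) (Omega_connected : connected Omega)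
  (Omega_bounded : bounded_set Omega) (Omega_nonempty : Omega !=set0)
  (sigma : R -> R) (sigma_continuous : continuous sigma)
  (pnorm : forall ws : seq nat, params d ws -> R)
  (pnorm_norm : forall ws : seq nat, is_norm (pnorm ws))
  (* problem *)
  (X0 X1 XA Y : completeNormedModType R)
  (fs0 : function_space Omega X0) (fs1 : function_space Omega X1)
  (i10 : {linear X1 -> X0}) (i1A : {linear X1 -> XA})
  (A : XA -> Y) (F : set X1) (fdag : X1) (g : Y) (gdata : R -> Y)
  (fdag_in_F : F fdag) (g_exact : g = A (i1A fdag))
  (gdata_noise : forall delta, 0 < delta -> `|gdata delta - g| <= delta)
  (* approximability *)
  (Nmin Lmin : nat) (Nmin_gt0 : (0 < Nmin)%N) (Lmin_gt0 : (0 < Lmin)%N)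
  (E : nat -> nat -> R)
  (E_ge0 : forall N L, (Nmin <= N)%N -> (Lmin <= L)%N -> 0 <= E N L)
  (E_nonincreasing : forall N N' L L', (Nmin <= N <= N')%N ->
     (Lmin <= L <= L')%N -> E N' L' <= E N L)
  (E_to0 : (fun NL : nat * nat => E NL.1 NL.2) @ filter_prod \oo \oo --> (0 : R))
  (approximable : forall f, F f ->
     forall N L, (Nmin <= N)%N -> (Lmin <= L)%N ->
     exists2 r : R, 0 < r &
     exists2 phi, networks_in fs1 sigma pnorm N L r phi & `|f - phi| <= E N L)
  (* topological setting *)
  (X1_reflexive : reflexive_space X1)
  (networks_in_X1 : forall N L r, (0 < N)%N -> (0 < L)%N -> 0 < r ->
     forall phi, networks sigma pnorm N L r phi ->
     exists f, represents fs1 f (fun t : Omega => phi (val t)))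
  (X1_in_X0 : function_embedding fs1 fs0 i10)
  (networks_compact : forall N L r, (0 < N)%N -> (0 < L)%N -> 0 < r ->
     compact (networks_in fs0 sigma pnorm N L r))
  (* forward operator *)
  (X1_in_XA : embedding i1A)
  (A_weakly_continuous : forall (fm : nat -> X1) (f : X1), weak_cvg fm f ->
     (exists M : R, forall m, `|fm m| <= M) ->
     weak_cvg (fun m => A (i1A (fm m))) (A (i1A f)))
  (unique_solution : forall f, A (i1A f) = g -> f = fdag)
  (theta LA eta : R) (theta_in01 : 0 < theta <= 1)
  (LA_gt0 : 0 < LA) (eta_gt0 : 0 < eta)
  (A_holder : forall f, `|f - fdag| <= eta ->
     `|A (i1A f) - A (i1A fdag)| <= LA * `|f - fdag| `^ theta)
  (* regularizer *)
  (Reg : X1 -> \bar R) (Reg_ge0 : forall f, (0 <= Reg f)%E)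
  (Reg_proper : exists f, (Reg f < +oo)%E)
  (Reg_lsc : forall (fm : nat -> X1) (f : X1), weak_cvg fm f ->
     (Reg f <= limn_einf (fun m => Reg (fm m)))%E)
  (Reg_coercive : forall M : R, exists rho : R, forall f,
     rho <= `|f| -> (M%:E <= Reg f)%E)
  (Reg_networks : forall N L r, (0 < N)%N -> (0 < L)%N -> 0 < r ->
     exists2 phi, networks_in fs1 sigma pnorm N L r phi & (Reg phi < +oo)%E)
  (C : R) (C_gt0 : 0 < C)
  (Reg_approximants : forall N L, (Nmin <= N)%N -> (Lmin <= L)%N ->
     exists2 r : R, 0 < r &
     exists phi, [/\ networks_in fs1 sigma pnorm N L r phi,
       `|fdag - phi| <= E N L & (Reg phi <= C%:E)%E])
  (* objective and target architecture *)
  (tau c0 : R) (tau_gt1 : 1 < tau) (c0_gt0 : 0 < c0)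
  (Ntar Ltar : R -> nat) (q0 : R) (q0_in01 : 0 < q0 <= 1)
  (target_ge_min : forall delta, 0 < delta ->
     (Nmin <= Ntar delta)%N /\ (Lmin <= Ltar delta)%N)
  (target_level : forall delta, 0 < delta ->
     q0 * target_error tau LA c0 C theta eta delta
       <= E (Ntar delta) (Ltar delta)
       <= target_error tau LA c0 C theta eta delta)
  (* expansion schedules, indexed by k >= 1 *)
  (Nk Lk : nat -> nat)
  (Nk_gt0 : forall k, (0 < k)%N -> (0 < Nk k)%N)
  (Lk_gt0 : forall k, (0 < k)%N -> (0 < Lk k)%N)
  (Nk_nondecreasing : forall k k', (0 < k <= k')%N -> (Nk k <= Nk k')%N)
  (Lk_nondecreasing : forall k k', (0 < k <= k')%N -> (Lk k <= Lk k')%N)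
  (Nk_unbounded : forall M, exists2 k, (0 < k)%N & (M <= Nk k)%N)
  (Lk_unbounded : forall M, exists2 k, (0 < k)%N & (M <= Lk k)%N)
  (CN CL : R) (CN_ge1 : 1 <= CN) (CL_ge1 : 1 <= CL)
  (Nk_growth : forall k, (0 < k)%N -> (Nk k.+1)%:R <= CN * (Nk k)%:R)
  (Lk_growth : forall k, (0 < k)%N -> (Lk k.+1)%:R <= CL * (Lk k)%:R)
  (schedule_frozen : forall delta, 0 < delta ->
     let kN := first_index (fun k => Ntar delta <= Nk k)%N in
     let kL := first_index (fun k => Ltar delta <= Lk k)%N in
     (forall k, (kN <= k <= maxn kN kL)%N -> Nk k = Nk kN) /\
     (forall k, (kL <= k <= maxn kN kL)%N -> Lk k = Lk kL))
  (qsc : R) (qsc_in01 : 0 < qsc <= 1)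
  (E_scaling : forall N L, (Nmin <= N)%N -> (Lmin <= L)%N ->
     qsc * E N L <= E (nat_ceil (CN * N%:R)) (nat_ceil (CL * L%:R)))
  (* radii of Algorithm I and of Algorithm II *)
  (rmax : nat -> nat -> R) (rI rII : nat -> R) :
  let NN := networks_in fs1 sigma pnorm in
  let T := fun f : X1 => A (i1A f) in
  let J := fun delta =>
    objective T (gdata delta) (weight c0 theta Nmin Lmin E) Reg in
  let kstar := fun delta =>
    maxn (first_index (fun k => Ntar delta <= Nk k)%N)
         (first_index (fun k => Ltar delta <= Lk k)%N) in
  (* standing assumptions on the radii in Algorithm I, Algorithm II *)
  let admissibleI :=
    [/\ forall N L, (0 < N)%N -> (0 < L)%N -> 0 < rmax N L,
        forall N N' L L', (0 < N <= N')%N -> (0 < L <= L')%N ->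
          rmax N L <= rmax N' L' &
        forall N L, (Nmin <= N)%N -> (Lmin <= L)%N ->
          exists phi, [/\ NN N L (rmax N L) phi, `|fdag - phi| <= E N L &
            (Reg phi <= C%:E)%E]] in
  let admissibleII :=
    [/\ forall k, (0 < k)%N -> 0 < rI k,
        forall j, (0 < j)%N -> 0 < rII j,
        forall j j', (0 < j <= j')%N -> rII j <= rII j' &
        rII j @[j --> \oo] --> +oo] in
  let stopI := fun delta =>
    algI_stop Nk Lk Nmin Lmin E eta T (gdata delta) (tau * delta) in
  let stop1 := fun delta =>
    algII_stop1 (J delta) Nk Lk (Ntar delta) (Ltar delta) (tau * delta) in
  let stop2 := fun delta =>
    algII_stop2 (J delta) (Ntar delta) (Ltar delta) (tau * delta) in
  let returnsI := fun delta =>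
    algI_returns NN (J delta) Nk Lk rmax Nmin Lmin E eta T (gdata delta)
      (tau * delta) in
  let returnsII := fun delta =>
    algII_returns NN (J delta) Nk Lk (Ntar delta) (Ltar delta) (tau * delta)
      rI rII in
  let controlled := fun delta (N L : nat) =>
    N%:R <= Num.max (Nk 1%N)%:R (CN * (Ntar delta)%:R) /\
    L%:R <= Num.max (Lk 1%N)%:R (CL * (Ltar delta)%:R) in
  [/\
    (* (a) *)
    forall delta, 0 < delta -> forall N L r, (0 < N)%N -> (0 < L)%N -> 0 < r ->
      exists f, minimizer (NN N L r) (J delta N L) f,
    (* (b) *)
    (admissibleI -> forall delta, 0 < delta ->
      (forall fs, algI_iterates NN (J delta) Nk Lk rmax fs ->
        exists2 k, first_at (stopI delta fs) k & (k <= kstar delta)%N) /\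
      (forall f N L, returnsI delta f N L -> controlled delta N L)) /\
    (admissibleII -> forall delta, 0 < delta ->
      (forall fs1, algII_iterates1 NN (J delta) Nk Lk rI fs1 ->
        exists k, [/\ first_at (stop1 delta fs1) k, (k <= kstar delta)%N &
          ~ algII_accept1 (J delta) Nk Lk (tau * delta) fs1 k ->
          forall fs2, algII_iterates2 NN (J delta) (Ntar delta) (Ltar delta)
                        rII fs2 ->
          exists j, first_at (stop2 delta fs2) j]) /\
      (forall f N L, returnsII delta f N L -> controlled delta N L))
    (* (c) *) &
    forall fsol : R -> X1,
      (forall delta, 0 < delta -> exists N L,
         (admissibleI /\ returnsI delta (fsol delta) N L) \/
         (admissibleII /\ returnsII delta (fsol delta) N L)) ->
      forall delta_ : nat -> R, (forall n, 0 < delta_ n) ->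
      nonincreasing_seq delta_ -> delta_ @ \oo --> (0 : R) ->
      [/\ weak_cvg (fun n => fsol (delta_ n)) fdag,
          A (i1A (fsol (delta_ n))) @[n --> \oo] --> g &
          forall (X2 : completeNormedModType R) (i12 : {linear X1 -> X2}),
            compact_embedding i12 ->
            i12 (fsol (delta_ n)) @[n --> \oo] --> i12 fdag]].
Proof.
move=> NN T J kstar admissibleI admissibleII stopI stop1 stop2 returnsI returnsII
  controlled.
have CN1 : 1 < CN := growth_gt1 Nk_unbounded Nk_growth.
have CL1 : 1 < CL := growth_gt1 Lk_unbounded Lk_growth.
have [theta0 _] := andP theta_in01.
have [qsc0 _] := andP qsc_in01.
have [q0_gt0 _] := andP q0_in01.
have tau0 : 0 < tau by exact: lt_trans tau_gt1.
pose te := target_error tau LA c0 C theta eta.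
have te0 delta : 0 < delta -> 0 < te delta by exact: target_error_gt0.
have Etar_gt0 delta : 0 < delta -> 0 < E (Ntar delta) (Ltar delta).
  move=> d0; have /andP[+ _] := target_level _ d0.
  by apply: lt_le_trans; rewrite mulr_gt0// te0.
have Escale := error_scaling Nmin_gt0 Lmin_gt0 CN1 CL1 qsc0 E_nonincreasing E_scaling.
(* Starting from the target at noise level 1, [N + L] scaling steps pass both indices, and each step
   keeps the level positive. *)
have E_gt0 N L : (Nmin <= N)%N -> (Lmin <= L)%N -> 0 < E N L.
  move=> NminN LminL; have [NminT LminT] := target_ge_min _ ltr01.
  apply: lt_le_trans (Escale (N + L)%N _ _ N L NminT LminT _ _).
  - by rewrite mulr_gt0// ?exprn_gt0// Etar_gt0.
  - rewrite NminN/=; apply: leq_trans (iter_scaling_ge _ CN1 (leq_trans Nmin_gt0 NminT)).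
    by rewrite addnCA leq_addr.
  - rewrite LminL/=; apply: leq_trans (iter_scaling_ge _ CL1 (leq_trans Lmin_gt0 LminT)).
    by rewrite addnA leq_addl.
pose Eext := error_ext Nmin Lmin E.
have EextE N L : (Nmin <= N)%N -> (Lmin <= L)%N -> Eext N L = E N L.
  by move=> NminN LminL; rewrite /Eext /error_ext !ltnNge NminN LminL.
have Eext_gt0 N L : 0 < Eext N L.
  rewrite /Eext /error_ext; case: ifPn => [_|]; first exact: E_gt0.
  by rewrite negb_or -!leqNgt => /andP[? ?]; exact: E_gt0.
pose b := weight c0 theta Nmin Lmin E.
(* A positive weight lets the objective bound [Reg] and rules out the convention [0 * +oo = 0]. *)
have b0 N L : 0 < b N L by rewrite mulr_gt0// powR_gt0//; exact: Eext_gt0.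
have kstarP delta : 0 < delta -> [/\ (0 < kstar delta)%N,
    (Ntar delta <= Nk (kstar delta))%N, (Ltar delta <= Lk (kstar delta))%N &
    controlled delta (Nk (kstar delta)) (Lk (kstar delta))].
  move=> d0; have [frN frL] := schedule_frozen _ d0.
  have [kN0 NN1 NN2] := schedule_target Nk_unbounded (ltW (lt_trans ltr01 CN1))
    Nk_growth frN (leq_maxl _ _).
  have [_ LL1 LL2] := schedule_target Lk_unbounded (ltW (lt_trans ltr01 CL1))
    Lk_growth frL (leq_maxr _ _).
  by split=> //; rewrite /kstar leq_max kN0.
have kstar_controlled delta k : 0 < delta -> (0 < k <= kstar delta)%N ->
    controlled delta (Nk k) (Lk k).
  move=> d0 kk; have [_ _ _ [cN cL]] := kstarP _ d0; split.
    by apply: le_trans cN; rewrite ler_nat Nk_nondecreasing.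
  by apply: le_trans cL; rewrite ler_nat Lk_nondecreasing.
have J_le delta N L f c : (J delta N L f <= c%:E)%E ->
    `|T f - gdata delta| <= c /\ (Reg f <= (c / b N L)%:E)%E.
  move=> Jc; split.
    rewrite -lee_fin; apply: le_trans Jc; rewrite leeDl// mule_ge0//.
    by rewrite lee_fin ltW// b0.
  have : ((b N L)%:E * Reg f <= c%:E)%E.
    by apply: le_trans Jc; rewrite leeDr// lee_fin.
  by rewrite -lee_pdivlMl// -EFinM mulrC.
(* Required is only [E N L <= eta], not the target level: Algorithm I may stop earlier, and its
   output is compared with this bound as well. *)
have approximant_J delta N L phi : 0 < delta -> (Nmin <= N)%N -> (Lmin <= L)%N ->
    `|fdag - phi| <= E N L -> E N L <= eta -> (Reg phi <= C%:E)%E ->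
    (J delta N L phi <= (delta + (LA * E N L `^ theta + c0 * E N L `^ theta * C))%:E)%E.
  move=> d0 NminN LminL phiE Eeta phiC.
  have Tphi : `|T phi - gdata delta| <= delta + LA * E N L `^ theta.
    rewrite -(subrK g (T phi)) -addrA; apply: (le_trans (ler_normD _ _)).
    rewrite [leLHS]addrC; apply: lerD; first by rewrite (distrC g) gdata_noise.
    rewrite distrC in phiE; rewrite g_exact; apply: (le_trans (A_holder _ (le_trans phiE Eeta))).
    by rewrite ler_pM2l//; apply: ge0_ler_powR; rewrite ?nnegrE// ltW// ?E_gt0.
  rewrite addrA EFinD; apply: leeD; first by rewrite lee_fin.
  rewrite (_ : weight _ _ _ _ _ _ _ = c0 * E N L `^ theta); last first.
    by rewrite /weight -/Eext EextE.
  by rewrite [leRHS]EFinM lee_wpmul2l// lee_fin ltW// mulr_gt0// powR_gt0// E_gt0.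
have approximant_accepted delta N L phi : 0 < delta -> (Nmin <= N)%N ->
    (Lmin <= L)%N -> `|fdag - phi| <= E N L -> E N L <= te delta ->
    (Reg phi <= C%:E)%E -> (J delta N L phi <= (tau * delta)%:E)%E.
  move=> d0 NminN LminL phiE Ete phiC.
  have Eeta : E N L <= eta by exact: le_trans Ete (target_error_le_eta _ _ _ _ _ _ _).
  apply: (le_trans (approximant_J _ _ _ _ d0 NminN LminL phiE Eeta phiC)).
  have := target_error_bound tau_gt1 LA_gt0 c0_gt0 C_gt0 theta0 d0
    (ltW (E_gt0 _ _ NminN LminL)) Ete.
  by rewrite lee_fin; lra.
have E_kstar delta : 0 < delta -> [/\ (Nmin <= Nk (kstar delta))%N,
    (Lmin <= Lk (kstar delta))%N & E (Nk (kstar delta)) (Lk (kstar delta)) <= te delta].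
  move=> d0; have [_ kN kL _] := kstarP _ d0.
  have [NT LT] := target_ge_min _ d0; have /andP[_ Ete] := target_level _ d0.
  split; [exact: leq_trans kN|exact: leq_trans kL|].
  by apply: le_trans Ete; apply: E_nonincreasing; rewrite ?NT ?LT.
have stopI_kstar : admissibleI -> forall delta, 0 < delta -> forall fs,
    algI_iterates NN (J delta) Nk Lk rmax fs -> stopI delta fs (kstar delta).
  move=> [_ _ adm] delta d0 fs fsP; have [k0 _ _ _] := kstarP _ d0.
  have [NminN LminL Ete] := E_kstar _ d0.
  have Eeta := le_trans Ete (target_error_le_eta _ _ _ _ _ _ _).
  split=> //; have [phi [NNphi phiE phiC]] := adm _ _ NminN LminL.
  have [_ fmin] := fsP _ k0.
  have [//] := J_le _ _ _ _ _ (le_trans (fmin _ NNphi)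
    (approximant_accepted _ _ _ _ d0 NminN LminL phiE Ete phiC)).
have stop1_kstar delta fs : 0 < delta -> stop1 delta fs (kstar delta).
  by move=> d0; have [_ ? ? _] := kstarP _ d0; right.
split.
- move=> delta d0 N L r N0 L0 r0.
  apply: (@minimizer_exists _ _ _ _ i10) => //; first exact: X1_in_X0.1.
  + rewrite (image_networks_in X1_in_X0); last exact: networks_in_X1.
    exact: networks_compact.
  + exact: Reg_networks.
- split=> [admI delta d0|admII delta d0]; split.
  + move=> fs fsP; have stopk := stopI_kstar admI _ d0 _ fsP.
    have [k0 _ _ _] := kstarP _ d0.
    have [k kP] := ex_first_at k0 stopk.
    by exists k => //; exact: first_at_le kP k0 stopk.
  + move=> f N L [fs [k [fsP kP [_ -> ->]]]]; apply: kstar_controlled => //.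
    have [k0 _ _ _] := kstarP _ d0; case: (kP) => -> _ _ /=.
    exact: first_at_le kP k0 (stopI_kstar admI _ d0 _ fsP).
  + move=> fs1' fsP; have stopk := stop1_kstar _ fs1' d0.
    have [k0 _ _ _] := kstarP _ d0.
    have [k kP] := ex_first_at k0 stopk.
    exists k; split=> // [|_ fs2 fs2P]; first exact: first_at_le kP k0 stopk.
    have [_ _ _ rIIoo] := admII.
    have [NT LT] := target_ge_min _ d0; have /andP[_ Ete] := target_level _ d0.
    have [r r0 [phi [NNphi phiE phiC]]] := Reg_approximants _ _ NT LT.
    (* Once the inflated radius exceeds the unknown radius [r], the class contains the approximant
       of [fdag]. The index [j.+1] is used because steps start at 1. *)
    have /cvgryPge/(_ r)[j _ rj] := rIIoo.
    apply: (@ex_first_at _ j.+1) => //; have [_ fmin] := fs2P j.+1 isT.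
    apply: le_trans (approximant_accepted _ _ _ _ d0 NT LT phiE Ete phiC).
    by apply: fmin; apply: networks_in_mono NNphi; exact: rj (leqnSn j).
  + move=> f N L [fs1' [k [fsP kP []]]].
      move=> [_ [_ -> ->]]; apply: kstar_controlled => //.
      have [k0 _ _ _] := kstarP _ d0; case: (kP) => -> _ _ /=.
      exact: first_at_le kP k0 (stop1_kstar _ _ d0).
    move=> [_ [fs2 [j [_ _ [_ -> ->]]]]].
    by split; rewrite le_max ler_peMl ?orbT.
- move=> fsol fsolP delta_ delta_gt0 delta_mono delta_to0.
  pose D := delta_ 0%N.
  have delta_D n : 0 < delta_ n <= D by rewrite delta_gt0/=; exact: delta_mono.
  have [kappa kappa0 kappaP] := target_error_lower tau_gt1 LA_gt0 c0_gt0 C_gt0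
    theta0 eta_gt0 (delta_gt0 0%N : 0 < D).
  (* [p.+1] scaling steps suffice for both indices at every noise level, so the output level is at
     least [q * te delta]. [K] is the resulting bound on the objective divided by the weight. *)
  pose p := (Nk 1%N + Lk 1%N)%N.
  pose q := qsc ^+ p.+1 * q0.
  have q_gt0 : 0 < q by rewrite mulr_gt0// exprn_gt0.
  pose K := (tau / (q `^ theta * kappa) + LA + c0 * C) / c0.
  (* The summand with [LA + c0 * C] is needed for Algorithm I; the outputs of Algorithm II satisfy
     the bound without it. *)
  have Reg_bound delta N L f : 0 < delta <= D ->
      qsc ^+ p.+1 * E (Ntar delta) (Ltar delta) <= Eext N L ->
      (J delta N L f <= (tau * delta + (LA + c0 * C) * Eext N L `^ theta)%:E)%E ->
      (Reg f <= K%:E)%E.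
    move=> dD lowE /J_le[_ /le_trans]; apply.
    rewrite lee_fin ler_pdivrMr//.
    have [d0 _] := andP dD; have /andP[lowT _] := target_level _ d0.
    have qte : q * te delta <= Eext N L.
      by apply: le_trans lowE; rewrite -mulrA ler_pM2l// exprn_gt0.
    have : q `^ theta * kappa * delta <= Eext N L `^ theta.
      rewrite -mulrA; apply: (@le_trans _ _ (q `^ theta * te delta `^ theta)).
        by rewrite ler_pM2l ?powR_gt0// kappaP.
      rewrite -powRM ?(ltW q_gt0) ?(ltW (te0 _ d0))//.
      apply: ge0_ler_powR; rewrite ?nnegrE ?(ltW theta0) ?(ltW (Eext_gt0 _ _))//.
      by rewrite mulr_ge0// ltW// te0.
    rewrite -[X in X <= _]mulrC -ler_pdivlMr ?mulr_gt0 ?powR_gt0// => dle.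
    have -> : K * b N L = tau * (Eext N L `^ theta / (q `^ theta * kappa)) +
        (LA + c0 * C) * Eext N L `^ theta.
      rewrite /K /b /weight -/Eext; field.
      by rewrite !gt_eqF// powR_gt0.
    by rewrite lerD2r ler_pM2l.
  have E_low delta k : 0 < delta -> (0 < k <= kstar delta)%N ->
      qsc ^+ p.+1 * E (Ntar delta) (Ltar delta) <= Eext (Nk k) (Lk k).
    move=> d0 kk; have [NT LT] := target_ge_min _ d0.
    have [cN cL] := kstar_controlled _ _ d0 kk.
    have Nlow := le_iter_scaling CN1 (leq_trans Nmin_gt0 NT) (leq_addr (Lk 1%N) (Nk 1%N)) cN.
    have Llow := le_iter_scaling CL1 (leq_trans Lmin_gt0 LT) (leq_addl (Nk 1%N) (Lk 1%N)) cL.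
    (* Below the minimal indices the level is [E Nmin Lmin], and the iterates from the target lie
       above these indices. *)
    rewrite /Eext /error_ext; case: ifPn => [_|].
      apply: Escale => //; rewrite leqnn andTb.
        apply: leq_trans (iter_scaling_ge _ CN1 (leq_trans Nmin_gt0 NT)).
        exact: leq_trans (leq_addr _ _).
      apply: leq_trans (iter_scaling_ge _ CL1 (leq_trans Lmin_gt0 LT)).
      exact: leq_trans (leq_addr _ _).
    rewrite negb_or -!leqNgt => /andP[NminN LminL].
    by apply: Escale; rewrite ?NminN ?LminL.
  have tau_le delta x : 0 < delta -> 0 < x ->
      ((tau * delta)%:E <= (tau * delta + (LA + c0 * C) * x `^ theta)%:E)%E.
    move=> d0 x0; rewrite lee_fin lerDl mulr_ge0 ?powR_ge0//.
    by rewrite addr_ge0 ?mulr_ge0 ?ltW.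
  have sol_bound n : (Reg (fsol (delta_ n)) <= K%:E)%E /\
      `|T (fsol (delta_ n)) - gdata (delta_ n)| <= tau * delta_ n.
    have d0 := delta_gt0 n; have [k0 _ _ _] := kstarP _ d0.
    have [N [L [[admI [fs [k [fsP kP [-> _ _]]]]]|
      [admII [fs [k [fsP kP [[acc [-> _ _]]|[_ [fs2 [j [fs2P jP [-> _ _]]]]]]]]]]]]]
      := fsolP _ d0.
    + have kk : (0 < k <= kstar (delta_ n))%N.
        case: (kP) => -> _ _ /=.
        exact: first_at_le kP k0 (stopI_kstar admI _ d0 _ fsP).
      (* Stopping controls the residual only, so the objective is bounded by that of the approximant
         in the same class. *)
      have [_ [NminN LminL Eeta acc] _] := kP; split=> //.
      apply: (Reg_bound _ _ _ _ (delta_D n) (E_low _ _ d0 kk)).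
      have [k_gt0 _] := andP kk.
      have [_ _ /(_ _ _ NminN LminL)[phi [NNphi phiE phiC]]] := admI.
      have [_ /(_ _ NNphi)/le_trans] := fsP _ k_gt0; apply.
      apply: (le_trans (approximant_J _ _ _ _ d0 NminN LminL phiE Eeta phiC)).
      rewrite EextE// lee_fin.
      have : delta_ n <= tau * delta_ n by rewrite ler_peMl ?ltW.
      by lra.
    + have kk : (0 < k <= kstar (delta_ n))%N.
        case: (kP) => -> _ _ /=.
        exact: first_at_le kP k0 (stop1_kstar _ _ d0).
      split; last by have [] := J_le _ _ _ _ _ acc.
      apply: (Reg_bound _ _ _ _ (delta_D n) (E_low _ _ d0 kk)).
      exact: le_trans acc (tau_le _ _ d0 (Eext_gt0 _ _)).
    + have [_ acc _] := jP; split; last by have [] := J_le _ _ _ _ _ acc.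
      have [NT LT] := target_ge_min _ d0.
      apply: (Reg_bound _ _ _ _ (delta_D n) _ (le_trans acc (tau_le _ _ d0 (Eext_gt0 _ _)))).
      rewrite EextE// ler_piMl ?(ltW (Etar_gt0 _ d0))//.
      by rewrite exprn_ile1 ?(ltW qsc0)//; case/andP: qsc_in01.
  have [rho rhoP] := coercive_bounded K Reg_coercive.
  have sol_rho n : `|fsol (delta_ n)| <= rho by apply: rhoP; have [] := sol_bound n.
  have T_cvg : T (fsol (delta_ n)) @[n --> \oo] --> g.
    apply/cvgrPdist_le => e e0.
    (* The residual against [g] is at most [tau * delta] from acceptance plus [delta] from the
       noise. *)
    have e1 : 0 < e / (tau + 1) by rewrite divr_gt0// addr_gt0.
    near=> n.
    have dn : delta_ n <= e / (tau + 1).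
      rewrite -[leLHS]gtr0_norm// -[delta_ n]subr0 -normrN opprB.
      by near: n; move/cvgrPdist_le : delta_to0; exact.
    rewrite ler_pdivlMr ?addr_gt0// in dn; apply: le_trans dn.
    rewrite distrC -(subrK (gdata (delta_ n)) (T _)) -addrA.
    apply: (le_trans (ler_normD _ _)); rewrite mulrDr mulr1 (mulrC _ tau).
    by apply: lerD; [have [] := sol_bound n|exact: gdata_noise].
  have f_weak : weak_cvg (fun n => fsol (delta_ n)) fdag.
    exact: (weak_cvg_unique_solution X1_reflexive A_weakly_continuous
      unique_solution sol_rho T_cvg).
  split=> // X2 i12 ci12; apply: (weak_cvg_compact ci12 _ f_weak).
  exists rho; split=> [|M rhoM _ [n _ <-]]; first by rewrite num_real.
  exact: le_trans (sol_rho n) (ltW rhoM).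
Unshelve. all: by end_near. Qed.
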